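(* Let $j\ge 1$ and let $G_j$ be the $j$ times iterated wreath product of $\mathbb{Z}$ with $\mathbb{Z}$. Consider a switch-walk-switch symmetric finitely supported non-degenerate random walk $\mu_j$ on $G_j$. Then the radius of almost invariance of $(G_j,\mu_j)$ satisfies $$r_{\rm a.i.}(G_j,\mu_j)(n)\preceq \frac{n^{1/2^{j+1}}}{\sqrt{\ln n}} .$$
   Context: The wreath product $A\wr B$ is the semidirect product of $A$ and $\sum_A B$ (finitely supported functions $A\to B$), where $A$ acts by shifts; $A$ and $B$ are embedded in $A\wr B$ in the standard way ($B$ as functions supported at $e_A$). Set $G_0=\mathbb{Z}$ and $G_j=\mathbb{Z}\wr G_{j-1}$ for $j\ge 1$ (so $G_1=\mathbb{Z}\wr\mathbb{Z}$). A switch-walk-switch random walk on $A\wr B$ is given by $\mu=\mu_B*\mu_A*\mu_B$ with $\mu_A,\mu_B$ probability measures on $A$ and $B$; on $G_j$ this is applied at each level: $\mu_j=\mu_{j-1}*\nu_j*\mu_{j-1}$, where $\nu_j$ is a symmetric finitely supported measure on the acting group $\mathbb{Z}$ and $\mu_{j-1}$ is a measure of the same kind on $G_{j-1}$, with $\mu_0$ a symmetric finitely supported measure on $\mathbb{Z}$; non-degenerate means that the support of each of the measures on $\mathbb{Z}$ involved generates $\mathbb{Z}$. Let $G$ be generated by a finite set $S$, with word length $l_{G,S}$. For $r:\mathbb{N}\to[0,\infty)$, $(G,\mu)$ has almost invariant distributions on the scale $r(n)$ if for every $\epsilon>0$ and all sufficiently large $n$ there is $V_{\epsilon,n}\subset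 G$ with $\mu^{*n}(V_{\epsilon,n})\ge 1-\epsilon$ such that for all $h\in V_{\epsilon,n}$ and all $g\in G$ with $l_{G,S}(g)\le r(n)$ one has $\mu^{*n}(h)>0$ and $|\mu^{*n}(hg)/\mu^{*n}(h)-1|\le\epsilon$. The relation $r_{\rm a.i.}(G,\mu)(n)\preceq r(n)$ means: for any function $r'(n)$ such that $r'(n)/r(n)$ tends to infinity on some subsequence, $(G,\mu)$ does not have almost invariant distributions on the scale $r'(n)$. *)

(* Defs.v *)
From HB Require Import structures.
From mathcomp Require Import all_boot all_order all_algebra finmap.
From mathcomp Require Import all_classical all_reals all_analysis.

Set Implicit Arguments.
Unset Strict Implicit.
Unset Printing Implicit Defensive.

Import Order.TTheory GRing.Theory Num.Theory.
Import numFieldNormedType.Exports.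

Local Open Scope fset_scope.
Local Open Scope classical_set_scope.
Local Open Scope ring_scope.

(* [int] only carries its ring multiplication; this alias is the additive
   group of the integers, written multiplicatively. *)
Definition intg : Type := int.
HB.instance Definition _ := Choice.on intg.

Section IntGroup.
Let mul (x y : intg) : intg := (x : int) + (y : int).
Let inv (x : intg) : intg := - (x : int).
Let one : intg := 0 : int.

Let mulA : associative mul. Proof. exact: addrA. Qed.
Let mul1 : left_id one mul. Proof. exact: add0r. Qed.
Let mulr1 : right_id one mul. Proof. exact: addr0. Qed.
Let mulV : left_inverse one inv mul. Proof. exact: addNr. Qed.
Let mulVr : right_inverse one inv mul. Proof. exact: addrN. Qed.

HB.instance Definition _ := isGroup.Build intg mulA mul1 mulr1 mulV mulVr.
End IntGroup.

Definition wreath (A B : groupType) : Type :=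
  (A * {fsfun A -> B with 1%g})%type.
HB.instance Definition _ (A B : groupType) := Choice.on (wreath A B).

Section Wreath.
Variables A B : groupType.
Implicit Types (a x : A) (f g : {fsfun A -> B with 1%g}) (u v w : wreath A B).
Local Open Scope group_scope.

Definition fs_mul f g : {fsfun A -> B with 1%g} :=
  [fsfun x in (finsupp f `|` finsupp g)%fset => f x * g x].

Definition fs_inv f : {fsfun A -> B with 1%g} :=
  [fsfun x in finsupp f => (f x)^-1].

Definition fs_one : {fsfun A -> B with 1%g} := [fsfun].

Definition fs_shift a f : {fsfun A -> B with 1%g} :=
  [fsfun x in [fset a * y | y in finsupp f]%fset => f (a^-1 * x)].

Lemma fs_mulE f g x : fs_mul f g x = f x * g x.
Proof.
rewrite fsfunE in_fsetU.
by case: (finsuppP f x); case: (finsuppP g x) => //= _ _; rewrite mulg1.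
Qed.

Lemma fs_invE f x : fs_inv f x = (f x)^-1.
Proof. by rewrite fsfunE; case: (finsuppP f x) => //=; rewrite invg1. Qed.

Lemma fs_oneE x : fs_one x = 1.
Proof. by rewrite fsfunE. Qed.

Lemma fs_shiftE a f x : fs_shift a f x = f (a^-1 * x).
Proof.
rewrite fsfunE; case: ifPn => // /negP xN.
case: (finsuppP f (a^-1 * x)) => // xf; case: xN.
by apply/imfsetP; exists (a^-1 * x) => //=; rewrite mulVKg.
Qed.

Definition wr_mul u v : wreath A B := (u.1 * v.1, fs_mul u.2 (fs_shift u.1 v.2)).
Definition wr_one : wreath A B := (1, fs_one).
Definition wr_inv u : wreath A B := (u.1^-1, fs_shift u.1^-1 (fs_inv u.2)).

Let mulA : associative wr_mul.
Proof.
move=> u v w; congr pair => /=; first exact: mulgA.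
apply/fsfunP => x.
by rewrite !(fs_mulE, fs_shiftE) invgM !mulgA.
Qed.

Let mul1 : left_id wr_one wr_mul.
Proof.
case=> a f; congr pair => /=; first exact: mul1g.
by apply/fsfunP => x; rewrite fs_mulE fs_shiftE fs_oneE mul1g invg1 mul1g.
Qed.

Let mulr1 : right_id wr_one wr_mul.
Proof.
case=> a f; congr pair => /=; first exact: mulg1.
by apply/fsfunP => x; rewrite fs_mulE fs_shiftE fs_oneE mulg1.
Qed.

Let mulV : left_inverse wr_one wr_inv wr_mul.
Proof.
case=> a f; congr pair => /=; first exact: mulVg.
by apply/fsfunP => x; rewrite fs_mulE !fs_shiftE fs_invE mulVg fs_oneE.
Qed.

Let mulVr : right_inverse wr_one wr_inv wr_mul.
Proof.
case=> a f; congr pair => /=; first exact: mulgV.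
apply/fsfunP => x.
by rewrite fs_mulE !fs_shiftE fs_invE invgK mulVKg mulgV fs_oneE.
Qed.

HB.instance Definition _ := isGroup.Build (wreath A B) mulA mul1 mulr1 mulV mulVr.

Definition wr_inl a : wreath A B := (a, fs_one).
Definition wr_inr (b : B) : wreath A B := (1, [fsfun x in [fset 1]%fset => b]).

End Wreath.

Fixpoint iter_wreath (j : nat) : groupType :=
  if j is i.+1 then wreath intg (iter_wreath i) else intg.

(* Words are taken in the letters of [S] and their inverses; [S] itself need
   not be symmetric. *)
Section WordLength.
Variables (G : groupType) (S : {fset G}).

Definition spelled (g : G) (k : nat) : Prop :=
  exists w : seq G,
    [/\ size w = k, all (fun s => (s \in S) || (s^-1%g \in S)) w
      & \big[*%g/1%g]_(s <- w) s = g].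

Definition generates : Prop := forall g : G, exists k : nat, spelled g k.

(* The value is a junk 0 on elements outside the subgroup generated by [S]. *)
Definition word_length (g : G) : nat :=
  xget 0%N [set k : nat | spelled g k /\ forall m, spelled g m -> (k <= m)%N].

End WordLength.

(* Finitely supported real-valued functions on a group, seen as (densities of)
   finitely supported signed measures. *)
Notation fsmeas R G := {fsfun G -> R with 0%R}.

Section Measures.
Variable R : realType.

Definition is_prob (G : groupType) (mu : fsmeas R G) : Prop :=
  (forall x, 0 <= mu x) /\ \sum_(x <- finsupp mu) mu x = 1.

Definition is_sym (G : groupType) (mu : fsmeas R G) : Prop :=
  forall x : G, mu x^-1%g = mu x.

Definition mass (G : groupType) (mu : fsmeas R G) (V : set G) : R :=
  \sum_(x <- finsupp mu | x \in V) mu x.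

Definition pushfwd (G H : groupType) (f : G -> H) (mu : fsmeas R G) :
    fsmeas R H :=
  [fsfun y in [fset f x | x in finsupp mu] =>
     \sum_(x <- finsupp mu | f x == y) mu x].

Lemma pushfwdE (G H : groupType) (f : G -> H) (mu : fsmeas R G) (y : H) :
  pushfwd f mu y = \sum_(x <- finsupp mu | f x == y) mu x.
Proof.
rewrite fsfunE; case: ifPn => // /negP yN.
rewrite big_seq_cond big1 // => x /andP[xm /eqP fxy]; case: yN.
by apply/imfsetP; exists x.
Qed.

Definition convol (G : groupType) (mu nu : fsmeas R G) : fsmeas R G :=
  [fsfun g in [fset (x * y)%g | x in finsupp mu, y in finsupp nu] =>
     \sum_(x <- finsupp mu) mu x * nu (x^-1 * g)%g].

Lemma convolE (G : groupType) (mu nu : fsmeas R G) (g : G) :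
  convol mu nu g = \sum_(x <- finsupp mu) mu x * nu (x^-1 * g)%g.
Proof.
rewrite fsfunE; case: ifPn => // /negP gN.
rewrite big_seq big1 // => x xm.
case: (finsuppP nu) => [|xg]; first by rewrite mulr0.
case: gN; apply/imfset2P; exists x => //.
by exists (x^-1 * g)%g => //; rewrite mulVKg.
Qed.

Definition unit_mass (G : groupType) : fsmeas R G :=
  [fsfun x in [fset 1%g] => 1].

Definition convol_pow (G : groupType) (mu : fsmeas R G) (n : nat) : fsmeas R G :=
  iter n (convol mu) (unit_mass G).

Definition sws (A B : groupType) (muA : fsmeas R A) (muB : fsmeas R B) :
    fsmeas R (wreath A B) :=
  convol (convol (pushfwd (@wr_inr A B) muB) (pushfwd (@wr_inl A B) muA))
       (pushfwd (@wr_inr A B) muB).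

Definition nondeg_sym_prob (nu : fsmeas R intg) : Prop :=
  [/\ is_prob nu, is_sym nu & generates (finsupp nu)].

Fixpoint is_sws_walk (j : nat) : fsmeas R (iter_wreath j) -> Prop :=
  match j with
  | 0 => fun mu => nondeg_sym_prob mu
  | i.+1 => fun mu => exists (nu : fsmeas R intg) (mu' : fsmeas R (iter_wreath i)),
      [/\ nondeg_sym_prob nu, is_sws_walk mu' & mu = sws nu mu']
  end.

Definition almost_invariant (G : groupType) (S : {fset G}) (mu : fsmeas R G)
    (r : nat -> R) : Prop :=
  forall eps : R, 0 < eps ->
  \forall n \near \oo, exists V : set G,
    1 - eps <= mass (convol_pow mu n) V /\
    forall h g : G, V h -> (word_length S g)%:R <= r n ->
      0 < convol_pow mu n h /\
      `|convol_pow mu n (h * g)%g / convol_pow mu n h - 1| <= eps.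

(* For a rate [r] vanishing at some [n] the quotient below is a junk 0 there;
   only large indices matter for the divergence. *)
Definition radius_ai_preceq (G : groupType) (S : {fset G}) (mu : fsmeas R G)
    (r : nat -> R) : Prop :=
  forall r' : nat -> R,
    (forall n, 0 <= r' n) ->
    (exists phi : nat -> nat,
       {homo phi : m n / (m < n)%N} /\
       (r' (phi k) / r (phi k)) @[k --> \oo] --> +oo) ->
    ~ almost_invariant S mu r'.

End Measures.

(* Main.v *)
Require Import Defs.
From mathcomp Require Import all_boot all_order all_algebra finmap.
From mathcomp Require Import all_classical all_reals all_analysis.
From mathcomp Require Import ring lra zify.

(** The group element records a configuration of integer lamps, namely those
    of the innermost lamp group that are reached through the identity of all
    outer ones. The lamps of a window of polynomial size around the walker have
    typical size [n ^ (1 / 2 ^ (j + 1))], and none of them is larger than this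
    by more than a factor of order [sqrt (ln n)]. Almost invariance on a scale
    [R] forces these lamps to be spread out over [R * ln n]; so [R] is at most
    of the order of [n ^ (1 / 2 ^ (j + 1)) / sqrt (ln n)].

    The spread comes from a transport of mass ([mean_exceed_ge]). Let [v i] be
    the value of rank [i] among the lamps of the window. Raising by [b <= c * R]
    one of the [i] largest lamps multiplies the probability by nearly 1, and
    produces a configuration in which this lamp exceeds [v i] by [b]. At most
    [i] lamps can do so. Counting the pairs of a configuration and a lamp shows
    that with high probability more than half of the [i] largest lamps exceed
    [v i] by [b], hence that [v (i / 2) >= v i + b]. A window of [2 ^ L + 1]
    sites contains [L] dyadic ranks, and [L] is of order [ln n]; so on average
    the lamps are spread over a multiple of [L * b] ([gap_sum_le]).

    The bound on the lamps ([window_lamp_le]) uses that, given the path of the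
    walker, the lamps at a site form a random walk run for the number of visits
    to this site ([lamps_marginal]). One passes from level to level because the
    number of visits to a given site is of the order of the square root of the
    time. At the last level all sites of the window have to be visited at most
    that often simultaneously ([window_visits_le]), after which Chernoff's bound
    applies. Visits are controlled by Tanaka's formula for the absolute value:
    it bounds the expected local time by the mean displacement ([paths_bump])
    and exhibits the difference of the local times at two sites as a martingale
    of small quadratic variation ([paths_bump_diff]); neither needs a local
    limit theorem. Symmetry of the walk moves the window from the walker to the
    origin. *)

Set Implicit Arguments.
Unset Strict Implicit.
Unset Printing Implicit Defensive.

Import Order.TTheory GRing.Theory Num.Theory.

Local Open Scope ring_scope.

(** * Expectations *)

Section Expectation.
Variable R : realType.

(** Finitely supported measures, laws of paths and laws of the lamps given a
    path are all handled as positive normalized linear functionals: conditioning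
    then is composition of functionals, and no sample space is needed. *)
Record is_expectation (T : Type) (E : (T -> R) -> R) : Prop := IsExpectation {
  expeD : forall F G, E (fun x => F x + G x) = E F + E G;
  expeZ : forall c F, E (fun x => c * F x) = c * E F;
  expe_le : forall F G, (forall x, F x <= G x) -> E F <= E G;
  expe1 : E (fun=> 1) = 1 }.

Section Theory.
Variables (T : Type) (E : (T -> R) -> R) (EE : is_expectation E).

Lemma eq_expe F G : F =1 G -> E F = E G.
Proof. by move=> FG; congr E; apply/funext. Qed.

Lemma expe_cst c : E (fun=> c) = c.
Proof.
by rewrite -[in LHS](mulr1 c) (expeZ EE (c) (fun=> 1)) (expe1 EE) mulr1.
Qed.

Lemma expeZr c F : E (fun x => F x * c) = E F * c.
Proof. by rewrite mulrC -(expeZ EE); apply: eq_expe => x; rewrite mulrC. Qed.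

Lemma expeN F : E (fun x => - F x) = - E F.
Proof. by rewrite -mulN1r -(expeZ EE); apply: eq_expe => x; rewrite mulN1r. Qed.

Lemma expeB F G : E (fun x => F x - G x) = E F - E G.
Proof. by rewrite (expeD EE) expeN. Qed.

Lemma expe_ge0 F : (forall x, 0 <= F x) -> 0 <= E F.
Proof. by move=> F0; rewrite -(expe_cst 0); apply: (expe_le EE). Qed.

Lemma expe_sum (I : Type) (r : seq I) (P : pred I) (F : I -> T -> R) :
  E (fun x => \sum_(i <- r | P i) F i x) = \sum_(i <- r | P i) E (F i).
Proof.
elim: r => [|i r IH].
  rewrite big_nil -[RHS](expe_cst 0); apply: eq_expe => x.
  by rewrite big_nil.
rewrite big_cons -IH; case: ifP => Pi.
  rewrite -(expeD EE); apply: eq_expe => x; by rewrite big_cons Pi.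
by apply: eq_expe => x; rewrite big_cons Pi.
Qed.

Lemma expe_markov (a : R) F : 0 < a -> (forall x, 0 <= F x) ->
  E (fun x => (a <= F x)%R%:R) <= E F / a.
Proof.
move=> a0 F0; rewrite -expeZr; apply: (expe_le EE) => x.
case: (leP a (F x)) => h; first by rewrite ler_pdivlMr // mul1r.
by rewrite mulr_ge0 // invr_ge0 ltW.
Qed.

End Theory.

Lemma expectation_bind (T U : Type) (E : (T -> R) -> R)
    (K : T -> (U -> R) -> R) :
  is_expectation E -> (forall t, is_expectation (K t)) ->
  is_expectation (fun F => E (fun t => K t F)).
Proof.
move=> EE EK; split.
- move=> F G; rewrite -(expeD EE); apply: eq_expe => t; exact: (expeD (EK t)).
- move=> c F; rewrite -(expeZ EE); apply: eq_expe => t; exact: (expeZ (EK t)).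
- by move=> F G FG; apply: (expe_le EE) => t; apply: (expe_le (EK t)).
- rewrite -[RHS](expe1 EE); apply: eq_expe => t; exact: (expe1 (EK t)).
Qed.

Lemma expectation_map (T U : Type) (E : (T -> R) -> R) (f : T -> U) :
  is_expectation E -> is_expectation (fun F => E (fun t => F (f t))).
Proof.
by move=> EE; apply: (@expectation_bind _ _ E (fun t F => F (f t))).
Qed.

End Expectation.

Arguments eq_expe {R T E F G}.

(** * Finitely supported measures as expectations *)

Section Mean.
Variable R : realType.

Definition mean (G : choiceType) (mu : fsmeas R G) (F : G -> R) : R :=
  \sum_(x <- finsupp mu) mu x * F x.

Lemma mean_widen (G : choiceType) (mu : fsmeas R G) (D : {fset G}) F :
  (finsupp mu `<=` D)%fset -> mean mu F = \sum_(x <- D) mu x * F x.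
Proof.
move=> sD; apply: big_fset_incl => // x _ xN.
by rewrite fsfun_dflt ?mul0r.
Qed.

Lemma mean_expectation (G : groupType) (mu : fsmeas R G) :
  is_prob mu -> is_expectation (mean mu).
Proof.
move=> [m0 m1]; split.
- move=> F H; rewrite /mean -big_split /=; apply: eq_bigr => x _.
  by rewrite mulrDr.
- by move=> c F; rewrite /mean big_distrr /=; apply: eq_bigr => x _; ring.
- by move=> F H FH; apply: ler_sum => x _; apply: ler_wpM2l.
- by rewrite -[RHS]m1; apply: eq_bigr => x _; rewrite mulr1.
Qed.

Lemma mean_le_supp (G : groupType) (mu : fsmeas R G) F H : is_prob mu ->
  (forall x, x \in finsupp mu -> F x <= H x) -> mean mu F <= mean mu H.
Proof.
move=> [m0 _] FH; rewrite /mean big_seq [leRHS]big_seq.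
by apply: ler_sum => x xm; apply: ler_wpM2l => //; apply: FH.
Qed.

Lemma meanC (G H : choiceType) (mu : fsmeas R G) (nu : fsmeas R H)
    (F : G -> H -> R) :
  mean mu (fun x => mean nu (F x)) = mean nu (fun y => mean mu (F ^~ y)).
Proof.
rewrite /mean (eq_bigr (fun x => \sum_(y <- finsupp nu) mu x * (nu y * F x y))).
  rewrite exchange_big /=; apply: eq_bigr => y _.
  by rewrite big_distrr /=; apply: eq_bigr => x _; ring.
by move=> x _; rewrite big_distrr.
Qed.

Lemma mean_indic (G : groupType) (mu : fsmeas R G) (V : set G) :
  mass mu V = mean mu (fun x => (x \in V)%:R).
Proof.
rewrite /mass /mean big_mkcond; apply: eq_bigr => x _.
by case: ifP => _; rewrite ?mulr1 ?mulr0.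
Qed.

Lemma mean_unit (G : groupType) F : mean (unit_mass R G) F = F 1%g.
Proof.
rewrite (@mean_widen _ _ [fset 1%g]%fset) ?big_seq_fset1.
  by rewrite fsfunE inE eqxx mul1r.
by apply/fsubsetP => x; rewrite mem_finsupp fsfunE inE; case: ifP => //; rewrite eqxx.
Qed.

Lemma sum_ifeq (G : choiceType) (D : {fset G}) (a : G) (c : G -> R) :
  a \in D -> \sum_(x <- D) (if a == x then c x else 0) = c a.
Proof.
move=> aD; rewrite (big_fsetD1 a) //= eqxx big_seq big1 ?addr0 // => x.
by rewrite in_fsetD1 eq_sym => /andP[/negPf ->].
Qed.

Lemma mean_pushfwd (G H : groupType) (f : G -> H) (mu : fsmeas R G) F :
  mean (pushfwd f mu) F = mean mu (fun x => F (f x)).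
Proof.
rewrite (@mean_widen _ _ [fset f x | x in finsupp mu]%fset).
  transitivity (\sum_(y <- [fset f x | x in finsupp mu]%fset)
      \sum_(x <- finsupp mu) if f x == y then mu x * F y else 0).
    apply: eq_bigr => y _; rewrite pushfwdE big_mkcond big_distrl /=.
    by apply: eq_bigr => x _; case: ifP; rewrite ?mul0r.
  rewrite exchange_big /= /mean big_seq [RHS]big_seq; apply: eq_bigr => x xm.
  by rewrite (sum_ifeq (fun y => mu x * F y)) //; apply/imfsetP; exists x.
apply/fsubsetP => y; rewrite mem_finsupp fsfunE; case: ifP => //.
by rewrite eqxx.
Qed.

Lemma mean_convol (G : groupType) (mu nu : fsmeas R G) F :
  mean (convol mu nu) F = mean mu (fun x => mean nu (fun y => F (x * y)%g)).
Proof.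
set D := [fset (x * y)%g | x in finsupp mu, y in finsupp nu]%fset.
rewrite (@mean_widen _ _ D); last first.
  apply/fsubsetP => y; rewrite mem_finsupp fsfunE; case: ifP => //.
  by rewrite eqxx.
under eq_bigr => g _ do rewrite convolE big_distrl /=.
rewrite exchange_big /= /mean big_seq [RHS]big_seq; apply: eq_bigr => x xm.
under eq_bigr => g _ do rewrite -mulrA.
rewrite -big_distrr /=; congr (_ * _).
have -> : \sum_(g <- D) nu (x^-1 * g)%g * F g =
    \sum_(g <- [fset (x * y)%g | y in finsupp nu]%fset) nu (x^-1 * g)%g * F g.
  apply/esym/big_fset_incl.
    by apply/fsubsetP => g /imfsetP[y /= yn ->]; apply/imfset2P; exists x => //; exists y.
  move=> g _ gN; rewrite fsfun_dflt ?mul0r //; apply: contra gN => gn.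
  by apply/imfsetP; exists (x^-1 * g)%g => //=; rewrite mulVKg.
rewrite big_imfset /=; first by apply: eq_bigr => y _; rewrite mulKg.
by move=> y z _ _; apply: mulgI.
Qed.

Lemma mean1_total (G : groupType) (mu : fsmeas R G) :
  mean mu (fun=> 1) = \sum_(x <- finsupp mu) mu x.
Proof. by apply: eq_bigr => x _; rewrite mulr1. Qed.

Lemma convol_prob (G : groupType) (mu nu : fsmeas R G) :
  is_prob mu -> is_prob nu -> is_prob (convol mu nu).
Proof.
move=> Pm Pn; split.
  move=> g; rewrite convolE sumr_ge0 // => x _.
  by rewrite mulr_ge0 ?Pm.1 ?Pn.1.
rewrite -mean1_total mean_convol.
rewrite -[RHS](expe1 (mean_expectation Pm)); apply: eq_expe => x.
exact: (expe1 (mean_expectation Pn)).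
Qed.

Lemma pushfwd_prob (G H : groupType) (f : G -> H) (mu : fsmeas R G) :
  is_prob mu -> is_prob (pushfwd f mu).
Proof.
move=> Pm; split.
  by move=> y; rewrite pushfwdE sumr_ge0 // => x _; rewrite Pm.1.
by rewrite -mean1_total mean_pushfwd mean1_total Pm.2.
Qed.

Lemma convol_pow_prob (G : groupType) (mu : fsmeas R G) n :
  is_prob mu -> is_prob (convol_pow mu n).
Proof.
move=> Pm; elim: n => [|n IH]; last exact: convol_prob.
split.
  by move=> x; rewrite fsfunE; case: ifP.
by rewrite -mean1_total mean_unit.
Qed.

Lemma mean_powS (G : groupType) (mu : fsmeas R G) n F :
  mean (convol_pow mu n.+1) F =
  mean mu (fun x => mean (convol_pow mu n) (fun y => F (x * y)%g)).
Proof. exact: mean_convol. Qed.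

(** Only the first increment is split off by the definition of the powers; the
    symmetry of the powers compares the first increment with the last one. *)
Lemma mean_powSr (G : groupType) (mu : fsmeas R G) n F :
  mean (convol_pow mu n.+1) F =
  mean (convol_pow mu n) (fun y => mean mu (fun x => F (y * x)%g)).
Proof.
elim: n F => [|n IH] F.
  rewrite mean_powS !mean_unit; apply: eq_expe => x.
  by rewrite mean_unit mulg1 mul1g.
rewrite mean_powS mean_powS; apply: eq_expe => x; rewrite IH.
by apply: eq_expe => y; apply: eq_expe => z; rewrite mulgA.
Qed.

(** Symmetry in the form in which it passes to convolution powers and to
    switch-walk-switch measures. *)
Definition mean_sym (G : groupType) (mu : fsmeas R G) : Prop :=
  forall F, mean mu (fun x => F x^-1%g) = mean mu F.

Lemma is_sym_mean (G : groupType) (mu : fsmeas R G) : Defs.is_sym mu -> mean_sym mu.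
Proof.
move=> Sm F.
have Einv : finsupp mu = [fset x^-1%g | x in finsupp mu]%fset.
  apply/fsetP => x; apply/idP/imfsetP => /=.
    by move=> xm; exists x^-1%g; rewrite ?invgK // mem_finsupp Sm -mem_finsupp.
  by case=> y ym ->; rewrite mem_finsupp Sm -mem_finsupp.
rewrite /mean [in RHS]Einv big_imfset /=; last by move=> x y _ _; apply: invg_inj.
by apply: eq_bigr => x _; rewrite Sm.
Qed.

Lemma mean_sym_pow (G : groupType) (mu : fsmeas R G) n :
  mean_sym mu -> mean_sym (convol_pow mu n).
Proof.
move=> Sm; elim: n => [|n IH] F; first by rewrite !mean_unit invg1.
rewrite mean_powS mean_powSr meanC -[RHS]IH; apply: eq_expe => y.
rewrite -[RHS](Sm (fun x => F (y^-1 * x)%g)); apply: eq_expe => x.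
by rewrite invgM.
Qed.

End Mean.

(** * Random walks on the integers and their occupation times *)

Section Paths.
Variables (R : realType) (nu : fsmeas R intg).

(** Expectation over the successive increments of an [n]-step walk; positions
    are plain integers. *)
Fixpoint paths (n : nat) (F : seq int -> R) : R :=
  if n is m.+1 then mean nu (fun s => paths m (fun l => F ((s : int) :: l)))
  else F [::].

(** Additive functional of the positions strictly before the final time, for
    the walk started at [y]. *)
Fixpoint occ (phi : int -> R) (y : int) (l : seq int) : R :=
  if l is s :: l' then phi y + occ phi (y + s) l' else 0.

(** One step of the generator of the walk. *)
Definition drift (h : int -> R) (y : int) : R :=
  mean nu (fun s => h (y + (s : int))) - h y.

(** Conditional variance of the next increment of [mart]. *)
Definition fluct (h : int -> R) (y : int) : R :=
  mean nu (fun s => (h (y + (s : int)) - h y - drift h y) ^+ 2).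

(** The Doob decomposition of [h] along the walk started at [y]. *)
Definition mart (h : int -> R) (y : int) (l : seq int) : R :=
  h (foldl +%R y l) - h y - occ (drift h) y l.

Lemma occ_le phi psi y l : (forall z, phi z <= psi z) ->
  occ phi y l <= occ psi y l.
Proof. by move=> le; elim: l y => //= s l IH y; apply: lerD. Qed.

Lemma occ_sum (I : Type) (r : seq I) (phi : I -> int -> R) y l :
  occ (fun z => \sum_(i <- r) phi i z) y l = \sum_(i <- r) occ (phi i) y l.
Proof.
elim: l y => /= [|s l IH] y; first by rewrite big1.
by rewrite IH big_split.
Qed.

Lemma occZ c (phi : int -> R) y l :
  occ (fun z => c * phi z) y l = c * occ phi y l.
Proof. by elim: l y => /= [|s l IH] y; rewrite ?mulr0 // IH mulrDr. Qed.

Lemma occB (phi psi : int -> R) y l :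
  occ (fun z => phi z - psi z) y l = occ phi y l - occ psi y l.
Proof. by elim: l y => /= [|s l IH] y; rewrite ?subr0 // IH; ring. Qed.

Lemma occ_ge0 (phi : int -> R) y l : (forall z, 0 <= phi z) -> 0 <= occ phi y l.
Proof. by move=> le; elim: l y => //= s l IH y; apply: addr_ge0. Qed.

Lemma occ_shift (phi : int -> R) c y l :
  occ (fun z => phi (z + c)) y l = occ phi (y + c) l.
Proof. by elim: l y => //= s l IH y; rewrite IH addrAC. Qed.

Lemma foldl_addz (a y : int) l : foldl +%R (a + y) l = a + foldl +%R y l.
Proof. by elim: l y => //= s l IH y; rewrite -addrA IH. Qed.

Lemma paths_mean (G : choiceType) (mu : fsmeas R G) n (F : seq int -> G -> R) :
  paths n (fun l => mean mu (F l)) = mean mu (fun x => paths n (F ^~ x)).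
Proof.
elim: n F => [|n IH] F //=; rewrite meanC; apply: eq_expe => s.
exact: (IH (fun l => F ((s : int) :: l))).
Qed.

Hypothesis nuP : is_prob nu.

Let nuE := mean_expectation nuP.

Lemma paths_expectation n : is_expectation (paths n).
Proof.
elim: n => [|n IH]; first by split=> *; rewrite /= ?eqxx;auto.
apply: (@expectation_bind _ _ _ (mean nu)
  (fun s F => paths n (fun l => F ((s : int) :: l)))) => // s.
exact: (expectation_map (fun l => (s : int) :: l) IH).
Qed.

Lemma paths_occ_cst n c y : paths n (occ (fun=> c) y) = n%:R * c.
Proof.
elim: n y => [|n IH] y /=; first by rewrite mul0r.
rewrite (eq_expe (G := fun=> c + n%:R * c)).
  by rewrite (expe_cst nuE) mulrSr mulrDl mul1r addrC.
move=> s /=; have PE := paths_expectation n.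
by rewrite (expeD PE) (expe_cst PE) IH.
Qed.

Lemma mean_jump h y :
  mean nu (fun s => h (y + (s : int)) - h y - drift h y) = 0.
Proof. by rewrite !(expeB nuE) !(expe_cst nuE) /drift; ring. Qed.

(** A variance is at most the second moment about any other point. *)
Lemma fluct_le h y :
  fluct h y <= mean nu (fun s => (h (y + (s : int)) - h y) ^+ 2).
Proof.
rewrite /fluct -subr_ge0 -(expeB nuE).
rewrite (eq_expe (G := fun s => (2 * drift h y) * (h (y + (s : int)) - h y - drift h y)
  + drift h y ^+ 2)).
  by rewrite (expeD nuE) (expeZ nuE) mean_jump (expe_cst nuE) mulr0 add0r sqr_ge0.
by move=> s; ring.
Qed.

Lemma mart_cons h y s l :
  mart h y (s :: l) = (h (y + s) - h y - drift h y) + mart h (y + s) l.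
Proof. by rewrite /mart /=; ring. Qed.

Lemma paths_mart h n y : paths n (mart h y) = 0.
Proof.
elim: n y => [|n IH] y /=; first by rewrite /mart /=; ring.
rewrite -[RHS](mean_jump h y); apply: eq_expe => s.
have PE := paths_expectation n.
under eq_expe do rewrite mart_cons.
by rewrite (expeD PE) (expe_cst PE) IH addr0.
Qed.

(** Martingale increments are orthogonal, so their conditional variances add
    up along the path. *)
Lemma paths_mart_sq h n y :
  paths n (fun l => mart h y l ^+ 2) = paths n (occ (fluct h) y).
Proof.
elim: n y => [|n IH] y /=; first by rewrite /mart /= !subrr expr0n.
have PE := paths_expectation n.
transitivity (mean nu (fun s => (h (y + (s : int)) - h y - drift h y) ^+ 2
                        + paths n (occ (fluct h) (y + (s : int))))).
  apply: eq_expe => s; rewrite -IH.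
  set a := h _ - _ - _.
  rewrite (eq_expe (G := fun l => (a ^+ 2 + 2 * a * mart h (y + (s : int)) l)
                               + mart h (y + (s : int)) l ^+ 2)).
    rewrite (expeD PE) (expeD PE) (expe_cst PE) (expeZ PE) paths_mart.
    by rewrite mulr0 addr0.
  by move=> l; rewrite mart_cons -/a; ring.
rewrite (expeD nuE) -/(fluct h y).
under [RHS]eq_expe do rewrite (expeD PE) (expe_cst PE).
by rewrite (expeD nuE) (expe_cst nuE).
Qed.

End Paths.

Section Tanaka.
Variables (R : realType) (nu : fsmeas R intg) (K : nat).
Hypothesis nuP : is_prob nu.
Hypothesis nuS : mean_sym nu.
Hypothesis nuK : forall s, s \in finsupp nu -> `|(s : int)| <= K%:Z.

Let nuE := mean_expectation nuP.

Definition absz_real (z : int) : R := `|z|%:~R.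

(** The drift of the absolute value. It is a nonnegative function supported
    near the origin, so its occupation functional is a smeared local time; it
    replaces the local time because Tanaka's formula is exact for it. *)
Definition bump : int -> R := drift nu absz_real.

Lemma absz_real_lip x y : `|absz_real x - absz_real y| <= `|(x - y)%:~R|.
Proof. by rewrite /absz_real !intr_norm !intrB ler_dist_dist. Qed.


(** Averaging over [s] and [- s] reduces this to the convexity of the absolute
    value. *)
Lemma bump_ge0 z : 0 <= bump z.
Proof.
rewrite /bump /drift subr_ge0.
have -> : mean nu (fun s => absz_real (z + (s : int))) =
   mean nu (fun s => 2^-1 * (absz_real (z + (s : int)) + absz_real (z - (s : int)))).
  rewrite (expeZ nuE) (expeD nuE) -(nuS (fun s => absz_real (z + (s : int)))).
  rewrite (_ : mean nu (fun s => absz_real (z - (s : int))) =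
    mean nu (fun s => absz_real (z + (s^-1%g : int)))) //.
  by field.
rewrite -[leLHS](expe_cst nuE); apply: (expe_le nuE) => s.
rewrite /absz_real !intr_norm !intrB !intrD.
have := ler_normD ((z%:~R : R) + (s : int)%:~R) (z%:~R - (s : int)%:~R).
rewrite (_ : _ + _ + _ = 2 * z%:~R); last by ring.
rewrite normrM (ger0_norm (ler0n _ _)); lra.
Qed.

Lemma fluct_lip h z c : (forall x y, `|h x - h y| <= c * `|(x - y)%:~R|) ->
  fluct nu h z <= (c * K%:R) ^+ 2.
Proof.
move=> hl; apply: (le_trans (fluct_le _ _ _)) => //.
rewrite -[leRHS](expe_cst nuE); apply: mean_le_supp => // s sm.
rewrite -(real_normK (num_real (_ - _))) lerXn2r ?nnegrE //.
  have := hl (z + (s : int)) z; have := hl 1 0; rewrite subr0 normr1 mulr1.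
  move=> h1 _; rewrite mulr_ge0 ?(le_trans _ h1) //.
apply: (le_trans (hl _ _)).
have c0 : 0 <= c by have := hl 1 0; rewrite subr0 normr1 mulr1; apply: le_trans.
rewrite ler_wpM2l // addrAC subrr add0r.
by rewrite -intr_norm -[K%:R]/(K%:Z%:~R) ler_int nuK.
Qed.

Lemma drift_id y : drift nu (fun z => z%:~R) y = 0.
Proof.
rewrite /drift; under eq_expe do rewrite intrD.
rewrite (expeD nuE) (expe_cst nuE).
have : mean nu (fun s => (s : int)%:~R) = - mean nu (fun s => (s : int)%:~R) :> R.
  rewrite -[LHS](nuS (fun s => (s : int)%:~R)) -(expeN nuE).
  by apply: eq_expe => s; rewrite -intrN.
by move=> e; lra.
Qed.

Lemma occ0 l y (f : int -> R) : (forall z, f z = 0) -> occ f y l = 0.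
Proof. by move=> f0; elim: l y => //= s l IH y; rewrite f0 IH addr0. Qed.

Lemma paths_end_sq n :
  paths nu n (fun l => (foldl +%R 0 l)%:~R ^+ 2) <= n%:R * K%:R ^+ 2.
Proof.
have PE := paths_expectation nuP n.
have := paths_mart_sq nuP (fun z => z%:~R) n 0.
under eq_expe => l.
  rewrite /mart (_ : occ _ _ _ = 0) ?subr0; last by apply/occ0/drift_id.
  over.
move=> ->; rewrite -(paths_occ_cst nuP n _ 0); apply: (expe_le PE) => l.
apply: occ_le => z; rewrite -[K%:R]mul1r; apply: fluct_lip => x y.
by rewrite mul1r intrB.
Qed.

(** The first moment is bounded by the second one through
    [2 * lam * |u| <= u ^ 2 + lam ^ 2]. The scale [lam] is left free: it is of
    the order of the square root of [n], but no root of [n] has to be taken. *)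
Lemma paths_end_abs n (lam A : R) : 0 < lam -> n%:R <= A * lam ^+ 2 ->
  paths nu n (fun l => absz_real (foldl +%R 0 l)) <= (K%:R ^+ 2 * A + 1) / 2 * lam.
Proof.
move=> lam0 nA; have PE := paths_expectation nuP n.
have h := paths_end_sq n.
apply: (@le_trans _ _ (paths nu n (fun l =>
   (2 * lam)^-1 * (foldl +%R 0 l)%:~R ^+ 2 + lam / 2))).
  apply: (expe_le PE) => l; rewrite /absz_real intr_norm.
  set u := (_%:~R : R); rewrite -[u ^+ 2](real_normK (num_real u)).
  set v := `|u|.
  rewrite -(ler_pM2l (mulr_gt0 (@ltr0n R 2) lam0)) // mulrDr mulrA divff ?mul1r; last first.
    by rewrite mulf_neq0 ?lt0r_neq0.
  have := sqr_ge0 (v - lam); nra.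
rewrite (expeD PE) (expeZ PE) (expe_cst PE).
have : (2 * lam)^-1 * paths nu n (fun l => (foldl +%R 0 l)%:~R ^+ 2) <=
   (2 * lam)^-1 * (A * lam ^+ 2 * K%:R ^+ 2).
  rewrite ler_wpM2l ?invr_ge0 ?(mulr_ge0 _ (ltW lam0)) //.
  by apply: (le_trans h); rewrite ler_wpM2r ?sqr_ge0.
rewrite (_ : _ * (A * _ * _) = A * K%:R ^+ 2 / 2 * lam); last by field; rewrite lt0r_neq0.
move=> h2; rewrite [leRHS](_ : _ = A * K%:R ^+ 2 / 2 * lam + lam / 2) ?lerD2r; last by field.
  by rewrite (expeZ PE).
Qed.

(** Tanaka's formula: the expected smeared local time is the gain of the
    expected absolute value, which is at most the mean displacement. *)
Lemma paths_bump n y (lam A : R) : 0 < lam -> n%:R <= A * lam ^+ 2 ->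
  paths nu n (occ bump y) <= (K%:R ^+ 2 * A + 1) / 2 * lam.
Proof.
move=> lam0 nA; apply: le_trans (paths_end_abs lam0 nA).
have PE := paths_expectation nuP n.
have := paths_mart nuP absz_real n y; rewrite /mart (expeB PE) -/bump => /eqP.
rewrite subr_eq0 => /eqP <-; apply: (expe_le PE) => l.
rewrite -[y in foldl _ y](addr0 y) foldl_addz.
apply: le_trans (ler_norm _) _; apply: le_trans (absz_real_lip _ _) _.
by rewrite addrAC subrr add0r /absz_real intr_norm.
Qed.

(** The function whose drift is the difference of two bumps at distance [x]. *)
Let gap (x : nat) (z : int) : R := absz_real z - absz_real (z + x%:Z).

(** Away from the segment joining [- x] to the origin [gap] is constant on the
    range of one step. *)
Lemma fluct_gap_le (x : nat) (z : int) : fluct nu (gap x) z <=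
  (2 * K%:R) ^+ 2 * ((- x%:Z - K%:Z <= z)%R && (z <= K%:Z)%R)%:R.
Proof.
case: (boolP (_ && _)) => zI.
  rewrite mulr1; apply: fluct_lip => u v.
  rewrite /gap (_ : _ - _ - _ = (absz_real u - absz_real v) -
    (absz_real (u + x%:Z) - absz_real (v + x%:Z))); last by ring.
  apply: le_trans (ler_normB _ _) _; rewrite mulrDl mul1r.
  apply: lerD (absz_real_lip _ _) _; apply: le_trans (absz_real_lip _ _) _.
  by rewrite opprD addrACA subrr addr0.
rewrite mulr0; apply: (le_trans (fluct_le nuP _ _)).
rewrite -(expe_cst nuE 0); apply: mean_le_supp => // s sm.
rewrite (_ : gap x (z + (s : int)) = gap x z) ?subrr ?expr0n //.
have sK := nuK sm; rewrite /gap /absz_real -!intrB; congr (_%:~R).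
move: zI sK; rewrite negb_and -!ltNge; set t : int := s; lia.
Qed.

Hypothesis bump0 : 0 < bump 0.

Lemma indic_le_bump (x : nat) (z : int) :
  ((- x%:Z - K%:Z <= z)%R && (z <= K%:Z)%R)%:R <=
  \sum_(u < x + 2 * K + 1) (bump 0)^-1 * bump (z + (x%:Z + K%:Z - u%:Z)).
Proof.
have bi : 0 <= (bump 0)^-1 by rewrite invr_ge0 ltW.
case: (boolP (_ && _)) => zI; last first.
  by apply: sumr_ge0 => u _; rewrite mulr_ge0 // bump_ge0.
have uP : (absz (z + x%:Z + K%:Z)%R < x + 2 * K + 1)%N by lia.
rewrite (bigD1 (Ordinal uP)) //= (_ : z + _ = 0); last by lia.
rewrite mulVf ?lt0r_neq0 // lerDl.
by apply: sumr_ge0 => u _; rewrite mulr_ge0 // bump_ge0.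
Qed.

(** The local times at two points at distance [x] differ by much less than
    their size: up to a bounded term their difference is a martingale which
    moves only while the walk is near the segment joining the two points. *)
Lemma paths_bump_diff n (x : nat) (lam A : R) :
  0 < lam -> n%:R <= A * lam ^+ 2 ->
  paths nu n (fun l => (occ bump (- x%:Z) l - occ bump 0 l) ^+ 2) <=
  8 * x%:R ^+ 2 + 2 * (2 * K%:R) ^+ 2 *
    ((x + 2 * K + 1)%:R * ((bump 0)^-1 * ((K%:R ^+ 2 * A + 1) / 2 * lam))).
Proof.
move=> lam0 nA; have PE := paths_expectation nuP n.
have driftE z : drift nu (gap x) z = bump z - bump (z + x%:Z).
  have e : mean nu (fun s => absz_real (z + x%:Z + (s : int))) =
           mean nu (fun s => absz_real (z + (s : int) + x%:Z)).
    by apply: eq_expe => s; rewrite addrAC.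
  rewrite /bump /drift e /gap (expeB nuE (fun s => absz_real (z + (s : int)))
    (fun s => absz_real (z + (s : int) + x%:Z))).
  by ring.
have gapx z : `|gap x z| <= x%:R.
  apply: le_trans (absz_real_lip _ _) _.
  by rewrite opprD addNKr intrN normrN normr_nat.
apply: (@le_trans _ _ (paths nu n (fun l => 8 * x%:R ^+ 2 + 2 * mart nu (gap x) (- x%:Z) l ^+ 2))).
  apply: (expe_le PE) => l.
  have -> : occ bump (- x%:Z) l - occ bump 0 l =
      (gap x (foldl +%R (- x%:Z) l) - gap x (- x%:Z)) - mart nu (gap x) (- x%:Z) l.
    rewrite /mart (_ : drift nu (gap x) = fun z => bump z - bump (z + x%:Z)).
      by rewrite occB occ_shift addNr; ring.
    by apply/funext.
  move: (gapx (foldl +%R (- x%:Z) l)) (gapx (- x%:Z)).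
  rewrite !ler_norml; set a := gap _ _; set b := gap _ _; set m := mart _ _ _ _.
  move=> /andP[a1 a2] /andP[b1 b2].
  have : (a - b) ^+ 2 <= (2 * x%:R) ^+ 2.
    have := ler0n R x; nra.
  have := sqr_ge0 (a - b + m); nra.
rewrite (expeD PE) (expe_cst PE) (expeZ PE) paths_mart_sq // lerD2l.
rewrite -mulrA ler_wpM2l //.
apply: (@le_trans _ _ (paths nu n (fun l => (2 * K%:R) ^+ 2 *
   \sum_(u < x + 2 * K + 1) (bump 0)^-1 * occ bump (- x%:Z + (x%:Z + K%:Z - u%:Z)) l))).
  apply: (expe_le PE) => l.
  rewrite (eq_bigr (fun u : 'I_(x + 2 * K + 1) => occ (fun z =>
    (bump 0)^-1 * bump (z + (x%:Z + K%:Z - u%:Z))) (- x%:Z) l)).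
    rewrite -occ_sum -occZ; apply: occ_le => z.
    by apply: le_trans (fluct_gap_le x z) _; rewrite ler_wpM2l ?sqr_ge0 // indic_le_bump.
  by move=> u _; rewrite occZ (occ_shift bump).
rewrite (expeZ PE) ler_wpM2l ?sqr_ge0 // (expe_sum PE).
rewrite -[X in X%:R](card_ord (x + 2 * K + 1)) mulr_natl -sumr_const.
apply: ler_sum => u _; rewrite (expeZ PE) ler_wpM2l ?invr_ge0 ?(ltW bump0) //.
exact: paths_bump.
Qed.

End Tanaka.

(** A walk for which this vanishes has no step other than the neutral one, and
    then its support does not generate the integers. *)
Lemma bump_gt0 (R : realType) (nu : fsmeas R intg) :
  nondeg_sym_prob nu -> 0 < bump nu 0.
Proof.
case=> nuP _ nuG; have nuE := mean_expectation nuP.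
rewrite /bump /drift /absz_real normr0 subr0.
rewrite (eq_expe (G := fun s => `|(s : int)|%:~R)); last by move=> s; rewrite add0r.
rewrite lt_neqAle expe_ge0 ?andbT; last by move=> // s; rewrite ler0z.
  apply/eqP => /esym /eqP.
  rewrite /mean psumr_eq0; last first.
    by move=> s _; rewrite mulr_ge0 ?nuP.1 // ler0z.
  move=> /allP z0.
  have s0 s : s \in finsupp nu -> s = 1%g.
    move=> sm; have := z0 s sm; rewrite /= mulf_eq0.
    by move: (sm); rewrite mem_finsupp => /negPf -> /=; rewrite intr_eq0 normr_eq0 => /eqP.
  have [k [w [_ /allP wS wE]]] := nuG (1%Z : intg).
  have : \big[*%g/1%g]_(s <- w) s = 1%g :> intg.
    rewrite big_seq big1 // => s /wS /orP[/s0 //|/s0 h].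
    by rewrite -[s]invgK h invg1.
  by rewrite wE.
exact: nuE.
Qed.

Lemma step_bound (R : realType) (nu : fsmeas R intg) : exists K : nat,
  (0 < K)%N /\ forall s, s \in finsupp nu -> `|(s : int)| <= K%:Z.
Proof.
exists (\sum_(s <- finsupp nu) `|(s : int)|%N).+1; split=> // s sm.
rewrite (big_fsetD1 s) //=; lia.
Qed.

(** * The lamps of a switch-walk-switch walk, given the path of the walker *)

Section Lamps.
Variables (R : realType) (B : groupType) (muB : fsmeas R B).
Hypothesis muBP : is_prob muB.

(** Expectation over the lamp moves while the walker performs the increments
    [l]. *)
Fixpoint lamps (l : seq int) (F : wreath intg B -> R) : R :=
  if l is s :: l' then
    mean muB (fun b1 => mean muB (fun b2 => lamps l' (fun u =>
      F (wr_inr intg b1 * wr_inl B (s : intg) * wr_inr intg b2 * u)%g)))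
  else F 1%g.

Lemma lamps_cons s l F : lamps (s :: l) F =
  mean muB (fun b1 => mean muB (fun b2 => lamps l (fun u =>
      F (wr_inr intg b1 * wr_inl B (s : intg) * wr_inr intg b2 * u)%g))).
Proof. by []. Qed.

(** Number of lamp moves at the origin for a walker started at [y]: each step
    moves one lamp where it starts and one where it ends. *)
Fixpoint visits (y : int) (l : seq int) : nat :=
  if l is s :: l' then ((y == 0) + (y + s == 0)%R + visits (y + s)%R l')%N
  else 0%N.

Lemma mean_sws (nu : fsmeas R intg) F :
  mean (sws nu muB) F = mean muB (fun b1 => mean nu (fun s =>
    mean muB (fun b2 => F (wr_inr intg b1 * wr_inl B s * wr_inr intg b2)%g))).
Proof.
rewrite !mean_convol mean_pushfwd; apply: eq_expe => b1.
rewrite mean_pushfwd; apply: eq_expe => s.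
by rewrite mean_pushfwd.
Qed.

Lemma sws_prob (nu : fsmeas R intg) : is_prob nu -> is_prob (sws nu muB).
Proof. by move=> nuP; do 2?apply: convol_prob; apply: pushfwd_prob. Qed.

Lemma mean_pow_sws (nu : fsmeas R intg) n F :
  mean (convol_pow (sws nu muB) n) F = paths nu n (fun l => lamps l F).
Proof.
elim: n F => [|n IH] F; first by rewrite mean_unit.
rewrite mean_powS mean_sws meanC /=; apply: eq_expe => s.
rewrite (eq_expe (G := fun b1 => paths nu n (fun l => mean muB (fun b2 =>
  lamps l (fun u => F (wr_inr intg b1 * wr_inl B s * wr_inr intg b2 * u)%g))))).
  exact/esym/paths_mean.
move=> b1; rewrite paths_mean; apply: eq_expe => b2.
by rewrite IH.
Qed.

Lemma lamps_expectation l : is_expectation (lamps l).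
Proof.
elim: l => [|s l IH]; first by split=> *; rewrite /= ?eqxx; auto.
apply: (@expectation_bind _ _ _ (mean muB) (fun b1 F =>
  mean muB (fun b2 => lamps l (fun u =>
      F (wr_inr intg b1 * wr_inl B (s : intg) * wr_inr intg b2 * u)%g)))).
  exact: mean_expectation.
move=> b1; apply: (@expectation_bind _ _ _ (mean muB) (fun b2 F =>
  lamps l (fun u =>
      F (wr_inr intg b1 * wr_inl B (s : intg) * wr_inr intg b2 * u)%g))).
  exact: mean_expectation.
by move=> b2; apply: (expectation_map _ IH).
Qed.

(** The effect of prepending one step: the two lamp moves act first, and the
    remaining walk is seen from the new position. *)
Lemma step_lampE (b1 b2 : B) (s : intg) (u : wreath intg B) (x : intg) :
  (wr_inr intg b1 * wr_inl B s * wr_inr intg b2 * u)%g.2 x =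
  ((if x == 1 then b1 else 1) * (if x == s then b2 else 1) *
    u.2 (s^-1 * x))%g.
Proof.
rewrite /= !fs_mulE !fs_shiftE fs_oneE !fsfunE !inE !mul1g !mulg1.
rewrite (_ : (s^-1 * x == 1)%g = (x == s)) //.
by rewrite -(inj_eq (@mulgI _ s)) mulVKg mulg1.
Qed.

Lemma mean_pow_bool (a : bool) N F :
  mean (convol_pow muB (a + N)) F = mean muB (fun b =>
    mean (convol_pow muB N) (fun c => F ((if a then b else 1) * c)%g)).
Proof.
case: a; first by rewrite add1n mean_powS.
rewrite add0n (expe_cst (mean_expectation muBP)); apply: eq_expe => c.
by rewrite mul1g.
Qed.

(** The moves made at other sites average out, and those made at [x] are
    independent increments of the lamp walk. *)
Lemma lamps_marginal l (x : intg) F :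
  lamps l (fun u => F (u.2 x)) =
  mean (convol_pow muB (visits (- (x : int)) l)) F.
Proof.
elim: l x F => [|s l IH] x F; first by rewrite /= mean_unit fs_oneE.
transitivity (mean muB (fun b1 => mean muB (fun b2 =>
    mean (convol_pow muB (visits (- ((s : intg)^-1 * x)%g : int) l)) (fun b =>
      F ((if x == 1 then b1 else 1) * (if x == s :> intg then b2 else 1) * b)%g)))).
  rewrite lamps_cons; apply: eq_expe => b1; apply: eq_expe => b2; rewrite -IH.
  by apply: eq_expe => u; rewrite step_lampE.
rewrite [visits _ (_ :: _)]/=.
have -> : (- (x : int) == 0) = (x == 1%g) by rewrite oppr_eq0.
have -> : (- (x : int) + s == 0) = (x == s :> intg).
  by rewrite addrC subr_eq0 eq_sym.
have -> : (- (x : int) + s) = - (((s : intg)^-1 * x)%g : int).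
  by rewrite [in RHS]opprD opprK addrC.
set N := visits _ _.
rewrite -addnA mean_pow_bool; apply: eq_expe => b1.
rewrite mean_pow_bool; apply: eq_expe => b2; apply: eq_expe => b.
by rewrite mulgA.
Qed.

End Lamps.

Section Visits.
Variables (R : realType) (nu : fsmeas R intg).
Hypothesis nuN : nondeg_sym_prob nu.

Let nuP : is_prob nu. Proof. by case: nuN. Qed.
Let nuS : mean_sym nu. Proof. by case: nuN => _ /is_sym_mean. Qed.

(** Both endpoints of a step count, so up to one final visit every visit is
    counted twice; the indicator of the origin is dominated by the normalized
    bump. *)
Lemma visits_le_bump y l :
  (visits y l)%:R <= 2 * (bump nu 0)^-1 * occ (bump nu) y l + 1.
Proof.
have b0 := bump_gt0 nuN.
suff : (visits y l)%:R + (y == 0)%:R <= 2 * (bump nu 0)^-1 * occ (bump nu) y l + 1.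
  by apply: le_trans; rewrite lerDl.
elim: l y => [|s l IH] y /=; first by rewrite mulr0 !add0r lern1 leq_b1.
have := IH (y + s); rewrite !natrD.
have : (y == 0)%:R <= (bump nu 0)^-1 * bump nu y.
  case: eqP => [->|_]; first by rewrite mulVf ?lt0r_neq0.
  by rewrite mulr_ge0 ?invr_ge0 ?(ltW b0) ?bump_ge0.
set a := _^-1; set c := bump nu y; nra.
Qed.

Lemma paths_visits (A : R) : exists M : R, 0 <= M /\
  forall n y lam, 1 <= lam -> n%:R <= A * lam ^+ 2 ->
  paths nu n (fun l => (visits y l)%:R) <= M * lam.
Proof.
have [K [_ nuK]] := step_bound nu; have b0 := bump_gt0 nuN.
exists (2 * (bump nu 0)^-1 * `|(K%:R ^+ 2 * A + 1) / 2| + 1); split.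
  by rewrite addr_ge0 // !mulr_ge0 // invr_ge0 ltW.
move=> n y lam lam1 nA; have PE := paths_expectation nuP n.
apply: (@le_trans _ _ (paths nu n (fun l =>
  2 * (bump nu 0)^-1 * occ (bump nu) y l + 1))).
  by apply: (expe_le PE) => l; apply: visits_le_bump.
rewrite (expeD PE) (expeZ PE) (expe1 PE) [leRHS]mulrDl mul1r.
apply: lerD => //; rewrite -[leRHS]mulrA.
apply: ler_wpM2l; first by rewrite mulr_ge0 // invr_ge0 ltW.
apply: le_trans (paths_bump nuP nuS nuK y (lt_le_trans ltr01 lam1) nA) _.
by apply: ler_wpM2r; [exact: le_trans ler01 lam1|exact: ler_norm].
Qed.

(** The lamp at the origin is a walk on the lamp group run for a random time
    with expectation of the order of the square root of [n]; Markov's inequality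
    bounds that time. *)
Lemma origin_lamp_le (B : groupType) (muB : fsmeas R B) (A : R) : is_prob muB ->
  exists M : R, 0 <= M /\
  forall n (lam a delta : R) (F : B -> R), 1 <= lam -> n%:R <= A * lam ^+ 2 -> 0 < a ->
  (forall b, 0 <= F b <= 1) ->
  (forall N : nat, N%:R <= a * lam -> mean (convol_pow muB N) F <= delta) ->
  mean (convol_pow (sws nu muB) n) (fun u => F (u.2 1%g)) <= delta + M / a.
Proof.
move=> muBP; have [M [M0 HM]] := paths_visits A.
exists M; split=> // n lam a delta F lam1 nA a0 F01 HF.
have lam0 := lt_le_trans ltr01 lam1.
have PE := paths_expectation nuP n.
rewrite mean_pow_sws.
apply: (@le_trans _ _ (paths nu n (fun l => delta +
   ((a * lam <= (visits (- (1%g : intg) : int) l)%:R)%R : bool)%:R))).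
  apply: (expe_le PE) => l; rewrite (lamps_marginal muBP).
  have NE N := mean_expectation (convol_pow_prob N muBP).
  have d0 : 0 <= delta.
    apply: le_trans (HF 0%N _); last by rewrite mulr_ge0 ?ltW.
    by apply: (expe_ge0 (NE _)) => b; case/andP: (F01 b).
  case: (leP (a * lam) _) => h; last by rewrite addr0 HF ?(ltW h).
  rewrite -[leLHS]add0r lerD // -(expe1 (NE (visits (- (1%g : intg)) l))).
  by apply: (expe_le (NE _)) => b; case/andP: (F01 b).
rewrite (expeD PE) (expe_cst PE) lerD2l.
apply: le_trans (expe_markov PE _ _) _ => //; first by rewrite mulr_gt0.
rewrite ler_pdivrMr ?mulr_gt0 // mulrA divfK ?lt0r_neq0 //.
exact: HM.
Qed.

End Visits.

Section Chernoff.
Variables (R : realType) (mu : fsmeas R intg) (K : nat).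
Hypothesis muP : is_prob mu.
Hypothesis muS : mean_sym mu.
Hypothesis muK : forall s, s \in finsupp mu -> `|(s : int)| <= K%:Z.

(** From [exp (- t) >= 1 - t] by inversion. *)
Lemma expR_le_quad (t : R) : t <= 2^-1 -> expR t <= 1 + t + 2 * t ^+ 2.
Proof.
move=> t2; have t1 : 0 < 1 - t by lra.
have h := expR_ge1Dx (- t); rewrite expRN in h.
have e0 := expR_gt0 t.
have : expR t * (1 - t) <= 1.
  by rewrite -ler_pdivlMl // mulr1.
move=> h2; rewrite -(ler_pM2r t1); apply: (le_trans h2); nra.
Qed.

(** The linear term of the quadratic bound vanishes by symmetry. *)
Lemma mean_expR_le theta : `|theta| * K%:R <= 2^-1 ->
  mean mu (fun s => expR (theta * (s : int)%:~R)) <= expR (2 * (theta * K%:R) ^+ 2).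
Proof.
move=> tK; have mE := mean_expectation muP.
apply: le_trans (expR_ge1Dx _).
apply: (@le_trans _ _ (mean mu (fun s => theta * (s : int)%:~R +
   (1 + 2 * (theta * K%:R) ^+ 2)))).
  apply: mean_le_supp => // s sm.
  have sK : `|(s : int)%:~R| <= K%:R :> R.
    by rewrite -intr_norm -[K%:R]/(K%:Z%:~R) ler_int muK.
  have tsK : `|theta * (s : int)%:~R| <= `|theta| * K%:R.
    by rewrite normrM ler_wpM2l.
  apply: le_trans (expR_le_quad _) _.
    by apply: le_trans (ler_norm _) _; apply: le_trans tsK tK.
  rewrite [1 + theta * _]addrC -addrA lerD2l lerD2l ler_wpM2l //.
  by rewrite !exprMn ler_wpM2l ?sqr_ge0 // -[leLHS]real_normK ?num_real // lerXn2r ?nnegrE.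
rewrite (expeD mE) (expe_cst mE) (expeZ mE).
have := drift_id muP muS 0; rewrite /drift.
under eq_expe do rewrite add0r.
by rewrite subr0 => ->; rewrite mulr0 add0r.
Qed.

Lemma pow_expR_le theta N : `|theta| * K%:R <= 2^-1 ->
  mean (convol_pow mu N) (fun z => expR (theta * (z : int)%:~R)) <=
  expR (2 * (theta * K%:R) ^+ 2 * N%:R).
Proof.
move=> tK; have mE := mean_expectation muP; elim: N => [|N IH].
  by rewrite mean_unit !mulr0 lexx.
rewrite mean_powS.
under eq_expe => x.
  under eq_expe => y.
    rewrite (_ : _%:~R = (x : int)%:~R + (y : int)%:~R); last exact: intrD.
    rewrite mulrDr expRD; over.
  rewrite (expeZ (mean_expectation (convol_pow_prob N muP))); over.
rewrite (expeZr mE)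
   -(addn1 N) (natrD _ N 1) mulrDr mulr1 [X in expR X]addrC expRD.
apply: ler_pM; rewrite ?mean_expR_le //.
  by apply: (expe_ge0 mE) => s; rewrite expR_ge0.
by apply: (expe_ge0 (mean_expectation (convol_pow_prob N muP))) => s; rewrite expR_ge0.
Qed.

(** Chernoff's bound, with the exponential weight left free. *)
Lemma pow_tail_le theta (lam : R) N : 0 <= theta -> theta * K%:R <= 2^-1 ->
  mean (convol_pow mu N) (fun z => ((lam < `|(z : int)%:~R|)%R : bool)%:R) <=
  2 * expR (2 * (theta * K%:R) ^+ 2 * N%:R - theta * lam).
Proof.
move=> t0 tK; have NE := mean_expectation (convol_pow_prob N muP).
apply: (@le_trans _ _ (mean (convol_pow mu N) (fun z =>
   expR (theta * (z : int)%:~R) * expR (- (theta * lam)) +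
   expR (- theta * (z : int)%:~R) * expR (- (theta * lam))))).
  apply: (expe_le NE) => z; rewrite -!expRD.
  case: ltP => h; last by rewrite addr_ge0 ?expR_ge0.
  move: h; rewrite lter_normr; set w := _%:~R; case/orP => h.
    apply: (@le_trans _ _ (expR (theta * w - theta * lam))); last first.
      by rewrite lerDl expR_ge0.
    apply: le_trans (expR_ge1Dx _); rewrite lerDl -mulrBr mulr_ge0 //; lra.
  apply: (@le_trans _ _ (expR (- theta * w - theta * lam))); last first.
    by rewrite lerDr expR_ge0.
  apply: le_trans (expR_ge1Dx _); rewrite lerDl mulNr -mulrN -mulrBr mulr_ge0 //; lra.
rewrite (expeD NE) !(expeZr NE) expRD mulr2n mulrDl mul1r.
apply: lerD; rewrite ler_wpM2r ?expR_ge0 //.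
  by apply: pow_expR_le; rewrite ger0_norm.
rewrite (_ : theta * K%:R = - (- theta * K%:R)); last by ring.
by rewrite sqrrN pow_expR_le // normrN ger0_norm.
Qed.

End Chernoff.

(** * The lamps of a window are not large *)

Section Window.
Variable R : realType.

(** Along most paths every site of the window is visited at most on the order
    of the square root of the time. A union bound over single sites would lose
    a factor [q]; only the differences with the local time at the origin, which
    are small in mean square, are summed over the window. *)
Lemma window_visits_le (nu : fsmeas R intg) (delta A : R) :
  nondeg_sym_prob nu -> 0 < delta -> 0 <= A ->
  exists A1 : R, 0 <= A1 /\ forall q n, (0 < q)%N -> n%:R <= A * (q%:R ^+ 8) ^+ 2 ->
  paths nu n (fun l => (~~ [forall x : 'I_q.+1,
     ((visits (- (x : nat)%:Z) l)%:R <= A1 * q%:R ^+ 8)%R])%:R) <= delta.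
Proof.
move=> nuN d0 A0; case: (nuN) => nuP /is_sym_mean nuS _.
have [K [_ nuK]] := step_bound nu; have b0 := bump_gt0 nuN.
set b := bump nu 0 in b0; set C := (K%:R ^+ 2 * A + 1) / 2.
have C0 : 0 <= C by rewrite divr_ge0 // addr_ge0 // mulr_ge0 // ?sqr_ge0.
have bi : 0 <= b^-1 by rewrite invr_ge0 ltW.
set E := b^-1 * C; have E0 : 0 <= E by rewrite mulr_ge0.
set D := 8 + 2 * (2 * K%:R) ^+ 2 * ((2 * K + 2)%:R * E).
have D0 : 0 <= D.
  by apply: addr_ge0 => //; apply: mulr_ge0; apply: mulr_ge0; rewrite ?sqr_ge0.
(* The first event costs [C / a], the union over the window [2 * D / a]. *)
set a := 1 + (C + 2 * D) / delta.
have a1 : 1 <= a by rewrite lerDl; apply: divr_ge0 (ltW d0); apply: addr_ge0 => //; apply: mulr_ge0.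
have a0 : 0 < a := lt_le_trans ltr01 a1.
exists (4 * a * b^-1 + 1); split.
  by apply: addr_ge0 => //; do 2!apply: mulr_ge0 => //; apply: ltW.
move=> q n q0; have [lam lamE] : exists lam : R, lam = q%:R ^+ 8 by exists (q%:R ^+ 8).
rewrite -lamE => nA.
have q1 : 1 <= q%:R :> R by rewrite ler1n.
have lam1 : 1 <= lam by rewrite lamE exprn_ege1.
have lam0 : 0 < lam := lt_le_trans ltr01 lam1.
have al0 := mulr_gt0 a0 lam0.
have PE := paths_expectation nuP n.
set gapx := fun (x : nat) l => (occ (bump nu) (- x%:Z) l - occ (bump nu) 0 l) ^+ 2.
apply: (@le_trans _ _ (paths nu n (fun l => (a * lam <= occ (bump nu) 0 l)%R%:R +
    \sum_(x < q.+1) ((a * lam) ^+ 2 <= gapx x l)%R%:R))).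
  apply: (expe_le PE) => l; case: forallP => [_|/forallP]; first
    by rewrite addr_ge0 // sumr_ge0.
  rewrite negb_forall => /existsP[x]; rewrite -ltNge => hx.
  have hb := visits_le_bump nuN (- (x : nat)%:Z) l.
  have big : 2 * (a * lam) < occ (bump nu) (- (x : nat)%:Z) l.
    have c0 : 0 < 2 * b^-1 by rewrite mulr_gt0 // invr_gt0.
    have e : (4 * a * b^-1 + 1) * lam = 2 * b^-1 * (2 * (a * lam)) + lam by ring.
    move: (lt_le_trans hx hb); rewrite e => h.
    rewrite -(ltr_pM2l c0) -(ltrD2r 1); apply: le_lt_trans h; by rewrite lerD2l.
  case: (leP (a * lam) (occ _ 0 l)) => h0.
    by rewrite lerDl sumr_ge0.
  rewrite add0r (bigD1 x) //= (_ : ((a * lam) ^+ 2 <= gapx x l) = true).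
    by rewrite lerDl sumr_ge0.
  rewrite /gapx lerXn2r ?nnegrE ?mulr_ge0 ?(ltW a0) ?(ltW lam0) //; last by lra.
  by have := mulr_gt0 a0 lam0; lra.
rewrite (expeD PE) (expe_sum PE).
have h1 : paths nu n (fun l => (a * lam <= occ (bump nu) 0 l)%R%:R) <= C / a.
  apply: le_trans (expe_markov PE (mulr_gt0 a0 lam0) _) _.
    by move=> l; apply: occ_ge0 => z; apply: bump_ge0.
  rewrite ler_pdivrMr ?al0 //. rewrite mulrA divfK ?lt0r_neq0 //.
  exact: (paths_bump nuP nuS nuK).
have h2 (x : 'I_q.+1) : paths nu n (fun l => ((a * lam) ^+ 2 <= gapx x l)%R%:R) <=
    (q%:R * lam * D) / (a * lam) ^+ 2.
  apply: le_trans (expe_markov PE _ _) _; first by rewrite exprn_gt0 // mulr_gt0.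
    by move=> l; rewrite ?sqr_ge0.
  rewrite ler_wpM2r ?invr_ge0 ?sqr_ge0 //.
  apply: le_trans (paths_bump_diff nuP nuS nuK b0 x lam0 nA) _.
  rewrite -/b -/C.
  have xq : (x : nat)%:R <= q%:R :> R by rewrite ler_nat -ltnS.
  have qlam : q%:R <= lam by rewrite lamE -[leLHS]expr1 ler_weXn2l.
  have -> : q%:R * lam * D = 8 * (q%:R * lam) + 2 * (2 * K%:R) ^+ 2 *
     ((q%:R * (2 * K + 2)%:R) * (b^-1 * (C * lam))) by rewrite /D /E; ring.
  apply: lerD.
    by apply: ler_wpM2l => //; rewrite expr2; apply: ler_pM => //; exact: le_trans xq qlam.
  apply: ler_wpM2l; first by rewrite mulr_ge0 ?sqr_ge0.
  apply: ler_wpM2r.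
    by apply: mulr_ge0 => //; apply: mulr_ge0 => //; apply: ltW.
  by rewrite -natrM ler_nat -addnA (addnS _ 1) mulnS leq_add ?leq_pmull // -ltnS.
apply: (@le_trans _ _ (C / a + \sum_(x < q.+1) (q%:R * lam * D) / (a * lam) ^+ 2)).
  by apply: lerD => //; apply: ler_sum.
rewrite sumr_const card_ord -[_ *+ q.+1]mulr_natl.
have h3 : q.+1%:R * (q%:R * lam * D / (a * lam) ^+ 2) <= 2 * D / a.
  rewrite mulrA ler_pdivrMr ?exprn_gt0 ?al0 //.
  have -> : 2 * D / a * (a * lam) ^+ 2 = (2 * (a * lam)) * (lam * D).
    by field; rewrite lt0r_neq0.
  have -> : q.+1%:R * (q%:R * lam * D) = (q.+1%:R * q%:R) * (lam * D) by ring.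
  rewrite ler_wpM2r ?mulr_ge0 ?(ltW lam0) //.
  have q2lam : q%:R * q%:R <= lam by rewrite -expr2 lamE ler_weXn2l.
  have : q.+1%:R <= 2 * q%:R :> R by rewrite -natrM ler_nat mul2n -addnn -add1n leq_add.
  move=> hq; apply: (@le_trans _ _ (2 * q%:R * q%:R)); first by rewrite ler_wpM2r.
  by rewrite -mulrA ler_wpM2l // (le_trans q2lam) // ler_peMl // ltW.
apply: (le_trans (lerD (lexx (C / a)) h3)).
have aE : delta * a = delta + (C + 2 * D) by rewrite /a; field; rewrite lt0r_neq0.
by rewrite -mulrDl ler_pdivrMr // aE lerDr ltW.
Qed.

Definition overflow (q : nat) (lam : R) (X : intg -> intg) : bool :=
  [exists x : 'I_q.+1, (lam < `|(X (x : nat)%:Z : int)%:~R|)%R].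

(** Along a good path every lamp of the window is a sum of at most [A1 * q ^ 8]
    independent steps. At the level [C * q ^ 4 * sqrt L] its tail is a large
    negative power of [q], which beats the number [q + 1] of sites. *)
Lemma window_lamps_le (nu mu0 : fsmeas R intg) (delta A : R) :
  nondeg_sym_prob nu -> nondeg_sym_prob mu0 -> 0 < delta -> 0 <= A ->
  exists (C : R) (L0 : nat), 0 <= C /\ forall L n, (L0 <= L)%N ->
  n%:R <= A * (2 ^ L)%:R ^+ 16 ->
  mean (convol_pow (sws nu mu0) n) (fun u =>
    (overflow (2 ^ L) (C * (2 ^ L)%:R ^+ 4 * Num.sqrt L%:R) u.2)%:R) <= delta.
Proof.
move=> nuN mu0N d0 A0; case: (nuN) => nuP _ _; case: (mu0N) => muP /is_sym_mean muS _.
have [K [K0 muK]] := step_bound mu0.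
have [A1 [A10 HA1]] := window_visits_le nuN (divr_gt0 d0 (@ltr0n R 2)) A0.
set D := 8 / delta; have D0 : 0 <= D by rewrite divr_ge0 // ltW.
set C := 2 * K%:R ^+ 2 * A1 + 2 + D.
have C0 : 0 <= C.
  by do 2!apply: addr_ge0 => //; do 2!apply: mulr_ge0 => //; apply: sqr_ge0.
exists C, K.+1; split=> // L n KL nA.
set q := (2 ^ L)%N in nA *; set rt := Num.sqrt L%:R.
have q0 : (0 < q)%N by rewrite expn_gt0.
have Lq : (L < q)%N by rewrite ltn_expl.
have qq0 : 0 < q%:R :> R by rewrite ltr0n.
have rt0 : 0 <= rt by rewrite sqrtr_ge0.
have rt2 : rt ^+ 2 = L%:R by rewrite sqr_sqrtr.
have rtL : rt <= L%:R.
  by rewrite -rt2 expr2 ler_peMl // -[leLHS]sqrtr1 ler_wsqrtr // ler1n; lia.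
have PE := paths_expectation nuP n.
rewrite mean_pow_sws.
set bad := fun l => ~~ [forall x : 'I_q.+1,
     ((visits (- (x : nat)%:Z) l)%:R <= A1 * q%:R ^+ 8)%R].
apply: (@le_trans _ _ (paths nu n (fun l => (bad l)%:R + delta / 2))); last first.
  rewrite (expeD PE) (expe_cst PE) [leRHS](splitr delta) lerD2r.
  by apply: HA1 => //; rewrite -exprM.
apply: (expe_le PE) => l; have LE := lamps_expectation muP l.
case: (boolP (bad l)) => [_|/negPn/forallP good].
  apply: (@le_trans _ _ 1); last by rewrite lerDl divr_ge0 // ltW.
  by rewrite -[leRHS](expe1 LE); apply: (expe_le LE) => u /=; rewrite lern1 leq_b1.
rewrite add0r; set Lam := C * _ * _.
apply: (@le_trans _ _ (lamps mu0 l (fun u => \sum_(x < q.+1)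
   (Lam < `|(u.2 (x : nat)%:Z : int)%:~R|)%R%:R))).
  apply: (expe_le LE) => u; rewrite /overflow; case: existsP => [[x hx]|_].
    by rewrite (bigD1 x) //= hx lerDl sumr_ge0.
  by rewrite sumr_ge0.
(* This weight balances the two terms of the Chernoff exponent: both become
   multiples of [L]. *)
rewrite (expe_sum LE); set theta := rt / q%:R ^+ 4.
have th0 : 0 <= theta by rewrite divr_ge0 // exprn_ge0 // ltW.
apply: (@le_trans _ _ (\sum_(x < q.+1) 2 * expR (- (2 + D) * L%:R))).
  apply: ler_sum => x _.
  rewrite (lamps_marginal muP l ((x : nat)%:Z : intg)
     (fun b => (Lam < `|(b : int)%:~R|)%R%:R)).
  apply: le_trans (pow_tail_le muP muS muK _ _ th0 _) _.
    rewrite /theta mulrAC ler_pdivrMr ?exprn_gt0 //.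
    apply: (@le_trans _ _ (q%:R * q%:R)).
      apply: ler_pM => //; last by rewrite ler_nat; lia.
      by apply: le_trans rtL _; rewrite ler_nat ltnW.
    have q2 : (2 <= q)%N by apply: leq_trans Lq; rewrite ltnS; apply: leq_trans KL.
    rewrite ler_pdivlMl // -natrX -!natrM ler_nat.
    rewrite (_ : q ^ 4 = (q * q) * (q * q))%N; last by rewrite !expnS expn0 muln1 !mulnA.
    by apply: leq_mul => //; apply: leq_trans q2 _; apply: leq_pmull.
  rewrite ler_wpM2l // ler_expR.
  have := good x; set N := visits _ _ => hN.
  apply: (@le_trans _ _ (2 * (theta * K%:R) ^+ 2 * (A1 * q%:R ^+ 8) - theta * Lam)).
    by rewrite lerD2r ler_wpM2l // mulr_ge0 // ?sqr_ge0.
  rewrite le_eqVlt; apply/orP; left; apply/eqP.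
  rewrite -rt2 /theta /Lam /C -/rt; field.
  by rewrite lt0r_neq0.
rewrite sumr_const card_ord -[_ *+ q.+1]mulr_natl.
have e1 : q.+1%:R <= 2 * expR L%:R :> R.
  apply: (@le_trans _ _ (2 * q%:R)); first by rewrite -natrM ler_nat; lia.
  rewrite ler_wpM2l // /q natrX -[L%:R]mulr1 expRM_natl lerXn2r ?nnegrE ?expR_ge0 //.
  by apply: le_trans (expR_ge1Dx 1).
apply: (@le_trans _ _ (2 * expR L%:R * (2 * expR (- (2 + D) * L%:R)))).
  by rewrite ler_wpM2r // mulr_ge0 // expR_ge0.
have L1 : 1 <= L%:R :> R by rewrite ler1n; lia.
apply: (@le_trans _ _ (4 * expR (- D))).
  rewrite (_ : _ * _ = 4 * (expR L%:R * expR (- (2 + D) * L%:R))); last by ring.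
  rewrite -expRD ler_wpM2l // ler_expR; nra.
have : expR (- D) <= (1 + D)^-1.
  rewrite expRN lef_pV2 ?posrE ?expR_gt0 ?expR_ge1Dx //; lra.
have : (1 + D)^-1 <= delta / 8.
  rewrite -[delta / 8]invrK invf_div lef_pV2 ?posrE ?divr_gt0 //; first by rewrite lerDr.
  by lra.
lra.
Qed.

End Window.

(** * Integer lamps of the iterated wreath product *)

Section IteratedLamps.
Variable R : realType.

(** The integer lamp at the address [(1, ..., 1, x)]: only the innermost base
    group, where the lamps are integers, is explored away from the identity. *)
Fixpoint lamp (j : nat) : iter_wreath j.+1 -> intg -> intg :=
  match j with
  | 0 => fun h x => h.2 x
  | i.+1 => fun h x => @lamp i (h.2 1%g) x
  end.

Lemma sws_walk_prob j (mu : fsmeas R (iter_wreath j)) :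
  is_sws_walk mu -> is_prob mu.
Proof.
elim: j mu => [|j IH] mu; first by case.
by case=> nu [mu' [[nuP _ _] /IH mu'P ->]]; apply: sws_prob.
Qed.

Lemma wr_inrV (A B : groupType) (b : B) :
  ((wr_inr A b)^-1 = wr_inr A b^-1)%g.
Proof.
congr pair; first by rewrite /= invg1.
apply/fsfunP => x; rewrite fs_shiftE fs_invE !fsfunE !inE invgK mul1g.
by case: ifP => // _; rewrite invg1.
Qed.

Lemma wr_inlV (A B : groupType) (a : A) :
  ((wr_inl B a)^-1 = wr_inl B a^-1)%g.
Proof.
congr pair; apply/fsfunP => x.
by rewrite fs_shiftE fs_invE !fs_oneE invg1.
Qed.

Lemma sws_walk_sym j (mu : fsmeas R (iter_wreath j)) :
  is_sws_walk mu -> mean_sym mu.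
Proof.
elim: j mu => [|j IH] mu; first by case=> _ /is_sym_mean.
case=> nu [mu' [[_ /is_sym_mean nuS _] /IH muS ->]] F.
rewrite !mean_sws.
transitivity (mean mu' (fun b1 => mean nu (fun s => mean mu' (fun b2 =>
    F (wr_inr intg b2 * wr_inl _ s * wr_inr intg b1)%g)))).
  rewrite -[RHS]muS; apply: eq_expe => b1; rewrite -[RHS]nuS.
  apply: eq_expe => s; rewrite -[RHS]muS; apply: eq_expe => b2.
  by rewrite !invgM wr_inlV !wr_inrV mulgA.
transitivity (mean nu (fun s => mean mu' (fun b1 => mean mu' (fun b2 =>
    F (wr_inr intg b2 * wr_inl _ s * wr_inr intg b1)%g)))); first exact: meanC.
rewrite [RHS]meanC; apply: eq_expe => s; exact: meanC.
Qed.

(** Each level of the wreath product replaces the time by its square root: the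
    lamp at the origin of the outer group is a walk on the lamp group run for
    about that long. After [j] levels the time is of the order of [q ^ 16]. *)
Lemma window_lamp_le j (mu : fsmeas R (iter_wreath j.+1)) (delta A : R) :
  is_sws_walk mu -> 0 < delta -> 0 <= A ->
  exists (C : R) (L0 : nat), 0 <= C /\ forall L n, (L0 <= L)%N ->
  n%:R <= A * (2 ^ L)%:R ^+ (2 ^ (j + 4)) ->
  mean (convol_pow mu n) (fun h =>
    (overflow (2 ^ L) (C * (2 ^ L)%:R ^+ 4 * Num.sqrt L%:R) (lamp h))%:R) <= delta.
Proof.
elim: j mu delta A => [|j IH] mu delta A.
  by case=> nu [mu' [nuN mu'N ->]]; apply: window_lamps_le.
case=> nu [mu' [nuN mu'W ->]] d0 A0.
have [M [M0 HM]] := origin_lamp_le nuN A (@sws_walk_prob j.+1 mu' mu'W).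
have d20 : 0 < delta / 2 by rewrite divr_gt0.
have a0 : 0 < M / (delta / 2) + 1 by rewrite ltr_wpDl // divr_ge0 // ltW.
have [C [L0 [C0 HC]]] := IH mu' (delta / 2) _ mu'W d20 (ltW a0).
exists C, L0; split=> // L n LL nA.
set Q := overflow _ _.
have ovf : forall b : iter_wreath j.+1, 0 <= ((Q (lamp b))%:R : R) <= 1.
  by move=> b; rewrite ler0n lern1 leq_b1.
have lam1 : 1 <= (2 ^ L)%:R ^+ (2 ^ (j + 4)) :> R.
  by rewrite exprn_ege1 // ler1n expn_gt0.
have nA2 : n%:R <= A * ((2 ^ L)%:R ^+ (2 ^ (j + 4))) ^+ 2.
  by rewrite -exprM -expnSr -addSn.
apply: (le_trans (HM n _ _ (delta / 2) (fun b => (Q (lamp b))%:R) lam1 nA2 a0 ovf _)).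
  by move=> N NA; apply: HC.
rewrite [leRHS](splitr delta) lerD2l ler_pdivrMr // mulrDr mulr1 mulrC.
by rewrite divfK ?lt0r_neq0 // lerDl ltW.
Qed.

(** Left multiplication by [raise x b] adds [b] to the lamp at [x]: the walker
    goes to [x], changes the lamp and comes back. *)
Definition raise (x b : nat) : wreath intg intg :=
  (wr_inl intg (x%:Z : intg) * wr_inr intg (b%:Z : intg) *
   wr_inl intg (x%:Z : intg)^-1)%g.

Lemma raiseE x b (y : intg) :
  (raise x b).1 = 1%g /\ (raise x b).2 y = if y == x%:Z then (b%:Z : intg) else 1%g.
Proof.
split; first by rewrite /= mulg1 mulgV.
rewrite /= !fs_mulE !fs_shiftE !fs_oneE mul1g mulg1 fsfunE inE.
by rewrite -[(_ == 1)%g](inj_eq (@mulgI _ (x%:Z : intg))) mulVKg mulg1.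
Qed.

Fixpoint embed (j : nat) (u : wreath intg intg) : iter_wreath j.+1 :=
  match j return iter_wreath j.+1 with
  | 0 => u
  | i.+1 => wr_inr intg (embed i u)
  end.

Lemma wr_inrM (A B : groupType) (b c : B) :
  (wr_inr A (b * c) = wr_inr A b * wr_inr A c)%g.
Proof.
congr pair; first by rewrite /= mulg1.
apply/fsfunP => x; rewrite fs_mulE fs_shiftE !fsfunE !inE invg1 mul1g.
by case: ifP; rewrite // mulg1.
Qed.

Lemma wr_inlM (A B : groupType) (a c : A) :
  (wr_inl B (a * c) = wr_inl B a * wr_inl B c)%g.
Proof.
congr pair; apply/fsfunP => x.
by rewrite fs_mulE fs_shiftE !fs_oneE mulg1.
Qed.

Lemma wr_inlX (A B : groupType) (a : A) n :
  (wr_inl B (a ^+ n) = (wr_inl B a) ^+ n)%g.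
Proof. by elim: n => [|n IH] //; rewrite !expgS wr_inlM IH. Qed.

Lemma wr_inrX (A B : groupType) (b : B) n :
  (wr_inr A (b ^+ n) = (wr_inr A b) ^+ n)%g.
Proof.
elim: n => [|n IH]; last by rewrite !expgS wr_inrM IH.
congr pair; apply/fsfunP => x; rewrite fsfunE fs_oneE !expg0.
by case: ifP.
Qed.

Lemma embedM j u v : embed j (u * v)%g = (embed j u * embed j v)%g.
Proof. by elim: j => [|j IH] //=; rewrite -wr_inrM IH. Qed.

Lemma embedX j u n : embed j (u ^+ n)%g = (embed j u ^+ n)%g.
Proof.
elim: j => [|j IH] //; rewrite [LHS]/= IH; exact: (wr_inrX intg).
Qed.

Lemma lamp_embed j u (h : iter_wreath j.+1) x :
  lamp (embed j u * h)%g x = (u.2 x * lamp h (u.1^-1 * x))%g.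
Proof.
elim: j h x => [|j IH] h x; first by rewrite /= fs_mulE fs_shiftE.
rewrite [LHS]/= fs_mulE fs_shiftE fsfunE inE eqxx invg1 mul1g.
exact: IH.
Qed.

Lemma lamp_raise j x b (h : iter_wreath j.+1) (y : nat) :
  (lamp (embed j (raise x b) * h)%g y%:Z : int) =
  (if y == x then b%:Z else 0) + lamp h y%:Z.
Proof.
rewrite lamp_embed (raiseE x b y%:Z).2 (raiseE x b y%:Z).1 invg1 mul1g.
by rewrite eqz_nat; case: ifP.
Qed.

End IteratedLamps.

Section WordLengths.
Variables (G : groupType) (S : {fset G}).

Lemma spelledM g h m n :
  spelled S g m -> spelled S h n -> spelled S (g * h)%g (m + n).
Proof.
move=> [v [<- vS <-]] [w [<- wS <-]]; exists (v ++ w).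
by rewrite size_cat all_cat vS wS big_cat.
Qed.

Lemma spelledX g k n : spelled S g k -> spelled S (g ^+ n)%g (n * k).
Proof.
move=> gk; elim: n => [|n IH].
  by exists [::]; rewrite big_nil.
by rewrite expgS mulSn; apply: spelledM.
Qed.

Lemma spelledV g k : spelled S g k -> spelled S g^-1%g k.
Proof.
move=> [w [<- wS <-]]; exists (rev (map (fun s => s^-1%g) w)).
rewrite size_rev size_map all_rev all_map; split=> //.
  by apply: sub_all wS => s /=; rewrite invgK orbC.
elim: w {wS} => [|s w IH]; first by rewrite !big_nil invg1.
by rewrite map_cons rev_cons -cats1 big_cat big_seq1 IH big_cons invgM.
Qed.

Lemma word_length_le g k : spelled S g k -> (word_length S g <= k)%N.
Proof.
move=> gk; rewrite /word_length; by case: xgetP => [m _ [_ ->]|].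
Qed.

End WordLengths.

(** The letters of [S] spell the two generators of the innermost wreath product,
    so the cost of raising is linear in the distance and in the increment. *)
Lemma raise_length j (S : {fset iter_wreath j.+1}) : generates S ->
  exists c : nat, (0 < c)%N /\ forall x b,
    (word_length S (embed j (raise x b))^-1%g <= c * (2 * x + b))%N.
Proof.
move=> SG.
have [k1 s1] := SG (embed j (wr_inl intg (1%Z : intg))).
have [k2 s2] := SG (embed j (wr_inr intg (1%Z : intg))).
have intX n : (n%:Z : intg) = ((1%Z : intg) ^+ n)%g.
  by elim: n => [|n IH] //; rewrite expgS -IH intS.
exists (k1 + k2).+1; split=> // x b.
apply: (@leq_trans (x * k1 + b * k2 + x * k1)); last by lia.
apply: word_length_le; apply: spelledV; rewrite /raise !embedM; apply: spelledM.
  apply: spelledM; rewrite intX ?wr_inlX ?wr_inrX embedX; exact: spelledX.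
have -> : embed j (wr_inl intg (x%:Z : intg)^-1%g) =
    (embed j (wr_inl intg (x%:Z : intg)))^-1%g.
  apply: (@mulgI _ (embed j (wr_inl intg (x%:Z : intg)))).
  rewrite mulgV -embedM -wr_inlM mulgV.
  exact: (embedX j 1%g 0).
by apply: spelledV; rewrite intX wr_inlX embedX; apply: spelledX.
Qed.

(** * Order statistics *)

Section OrderStatistics.
Variable I : finType.
Implicit Types (X : I -> int) (v t : int) (x y : I).

(** The value of rank [i], ranks being counted downwards from 0 and with
    multiplicity. Stated by counting, so that ties need no convention. *)
Definition is_ostat X (i : nat) v : Prop :=
  (i < #|[set x | (v <= X x)%R]|)%N /\ (#|[set x | (v < X x)%R]| <= i)%N.

(** The largest of the values which are reached by more than [i] entries. *)
Lemma ostat_exists X i : (i < #|I|)%N -> exists v, is_ostat X i v.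
Proof.
move=> iI; have x0 : I by apply: (enum_val (Ordinal iI)).
pose P x := (i < #|[set y | (X x <= X y)%R]|)%N.
pose xm := [arg min_(x < x0) X x]%O.
have Pm : P xm.
  rewrite /P /xm; case: Order.TotalTheory.arg_minP => //= x _ xmin.
  by rewrite cardsE (eq_card (B := predT)) // => y; rewrite !inE; apply: xmin.
exists (X [arg max_(x > xm | P x) X x]%O).
case: Order.TotalTheory.arg_maxP => //= x Px xmax; split=> //.
rewrite leqNgt; apply/negP => h.
have [z0 z0P] : exists z0, z0 \in [set y | (X x < X y)%R].
  by apply/card_gt0P; apply: leq_ltn_trans h.
have [z zP zmin] := Order.TotalTheory.arg_minP X z0P.
have : P z.
  rewrite /P; apply: (leq_trans h); apply: subset_leq_card.
  by apply/fintype.subsetP => y yP; rewrite inE; apply: zmin.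
have : z \in [set y | (X x < X y)%R] := zP.
by rewrite inE => xz /xmax; rewrite leNgt xz.
Qed.

Definition ostat X (i : nat) : int := xget 0 [set v | is_ostat X i v]%classic.

Lemma ostatP X i : (i < #|I|)%N -> is_ostat X i (ostat X i).
Proof. by move=> iI; apply: (@xgetPex _ 0 _ (ostat_exists X iI)). Qed.

Lemma le_ostat X i t : (i < #|I|)%N ->
  (i < #|[set x | (t <= X x)%R]|)%N -> t <= ostat X i.
Proof.
move=> /(ostatP X)[_ h] it; rewrite leNgt; apply/negP => vt.
move: it; rewrite ltnNge => /negP; apply; apply: leq_trans h.
by apply: subset_leq_card; apply/fintype.subsetP => x; rewrite !inE; apply: lt_le_trans.
Qed.

Lemma ostat_anti X i k : (i <= k < #|I|)%N -> ostat X k <= ostat X i.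
Proof.
move=> /andP[ik kI]; apply: le_ostat; first exact: leq_ltn_trans kI.
by apply: leq_ltn_trans ik _; have [] := ostatP X kI.
Qed.

Definition exceed X (i b : nat) : nat := #|[set x | (ostat X i + b%:Z <= X x)%R]|.

Lemma exceed_le X i b : (i < #|I|)%N -> (0 < b)%N -> (exceed X i b <= i)%N.
Proof.
move=> /(ostatP X)[_ h] b0; apply: leq_trans h; apply: subset_leq_card.
by apply/fintype.subsetP => x; rewrite !inE; apply: lt_le_trans; rewrite ltrDl.
Qed.

(** Entries tied with the value of rank [i - 1] are all included. *)
Lemma rank_count X i : (i <= #|I|)%N ->
  (i <= #|[set x | (#|[set y | (X x < X y)%R]| < i)%N]|)%N.
Proof.
case: i => // i iI; have [h1 h2] := ostatP X iI; apply: (leq_trans h1).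
apply: subset_leq_card; apply/fintype.subsetP => x; rewrite !inE => vx; rewrite ltnS.
apply: leq_trans h2; apply: subset_leq_card; apply/fintype.subsetP => y.
by rewrite !inE; apply: le_lt_trans.
Qed.

(** Otherwise, before being raised, [x] would lie below the value of rank [i],
    hence below the more than [i] entries that reach this value, [x] itself
    excepted. *)
Lemma raised_exceeds X X' x (i b : nat) : (i < #|I|)%N ->
  (forall y, X y = (if y == x then b%:Z else 0) + X' y) ->
  (#|[set y | (X' x < X' y)%R]| < i)%N -> ostat X i + b%:Z <= X x.
Proof.
move=> iI XE; rewrite ltnNge leNgt => /negP h; apply/negP => hx; apply: h.
have {hx} hx : X' x < ostat X i by move: hx; rewrite XE eqxx [b%:Z + _]addrC ltrD2r.
have [h1 _] := ostatP X iI; rewrite -ltnS; apply: (leq_trans h1).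
rewrite (cardsD1 x) -[X in (_ <= X)%N]add1n leq_add ?leq_b1 //.
apply: subset_leq_card; apply/fintype.subsetP => y; rewrite !inE => /andP[/negPf yx].
by rewrite XE yx add0r; apply: lt_le_trans.
Qed.

(** A summand is at most [b], and it is positive only if more than half of the
    [2 ^ l.+1] largest values exceed the value of that rank by [b]; but then so
    does the value of rank [2 ^ l]. *)
Lemma ostat_spread (R : realType) X (L b : nat) : (2 ^ L < #|I|)%N -> (0 < b)%N ->
  \sum_(l < L) b%:R * (2 * (exceed X (2 ^ l.+1) b)%:R / (2 ^ l.+1)%:R - 1) <=
  (ostat X 1 - ostat X (2 ^ L))%:~R :> R.
Proof.
move=> + b0; elim: L => [|L IH] LI; first by rewrite big_ord0 subrr.
have L2 : (2 ^ L <= 2 ^ L.+1)%N by rewrite leq_pexp2l.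
rewrite big_ord_recr /=; apply: (le_trans (lerD (IH (leq_ltn_trans L2 LI)) (lexx _))).
rewrite -[ostat X 1 - ostat X (2 ^ L.+1)](subrKA (ostat X (2 ^ L))).
rewrite [leRHS]intrD lerD2l.
set Z := exceed _ _ _; set q := (2 ^ L.+1)%N in L2 LI Z *.
have q0 : 0 < q%:R :> R by rewrite ltr0n expn_gt0.
have b00 : 0 <= b%:R :> R by [].
case: (ltnP (2 ^ L) Z) => hZ.
  apply: (@le_trans _ _ b%:R).
    rewrite ler_piMr // lerBlDr ler_pdivrMr // -[1 + 1]/(2%:R).
    by rewrite ler_wpM2l // ler_nat exceed_le.
  rewrite -[b%:R]/(b%:Z%:~R) ler_int lerBrDr addrC.
  by apply: le_ostat => //; apply: leq_ltn_trans LI.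
apply: (@le_trans _ _ 0).
  rewrite mulr_ge0_le0 // subr_le0 ler_pdivrMr // mul1r -natrM ler_nat.
  by rewrite /q expnS leq_mul2l.
by rewrite ler0z subr_ge0 ostat_anti // L2.
Qed.

Lemma ostat_range (R : realType) X i k (lam : R) : (i < #|I|)%N -> (k < #|I|)%N ->
  (forall x, `|(X x)%:~R| <= lam) -> (ostat X i - ostat X k)%:~R <= 2 * lam.
Proof.
move=> iI kI Xl.
have [h1 _] := ostatP X iI; have [_ h2] := ostatP X kI.
have [x xP] : exists x, x \in [set x | (ostat X i <= X x)%R].
  by apply/card_gt0P; apply: leq_ltn_trans h1.
have [y yP] : exists y, y \notin [set x | (ostat X k < X x)%R].
  apply/existsP; rewrite -negb_forall; apply/negP => /forallP h.
  move: (leq_ltn_trans h2 kI); by rewrite (eq_card (B := predT)) ?ltnn.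
move: xP yP; rewrite !inE -leNgt => xP yP.
apply: (@le_trans _ _ (X x - X y)%:~R); first by rewrite ler_int lerB.
rewrite intrB; have := Xl x; have := Xl y; rewrite !ler_norml.
by move=> /andP[? ?] /andP[? ?]; lra.
Qed.

End OrderStatistics.

(** * Transport of mass by raising lamps *)

Section Transport.
Variables (R : realType) (G : groupType) (P : fsmeas R G) (V : set G) (eps : R).
Hypotheses (PP : is_prob P) (PS : mean_sym P).
Hypotheses (eps1 : eps <= 1) (massV : 1 - eps <= mass P V).

Let PE := mean_expectation PP.

(** Almost invariance concerns right multiplication. The symmetry of [P] turns
    it into left multiplication, which acts on the lamps near the origin
    instead of those near the walker. *)
Lemma transport_le (g : G) F : (forall h, 0 <= F h) ->
  (forall h, V h -> (1 - eps) * P h <= P (h * g)%g) ->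
  (1 - eps) * mean P (fun h => (h \in V)%:R * F h^-1%g) <= mean P (fun h => F (g * h)%g).
Proof.
move=> F0 HV0.
have -> : mean P (fun h => F (g * h)%g) = mean P (fun h => F ((h * g^-1)^-1)%g).
  by rewrite -PS; apply: eq_expe => h; rewrite invgM invgK.
set D := [fset (h * g^-1)%g | h in finsupp P]%fset.
have -> : mean P (fun h => F ((h * g^-1)^-1)%g) =
    \sum_(k <- D) P (k * g)%g * F k^-1%g.
  rewrite /D big_imfset /=; last by move=> x y _ _; apply: mulIg.
  by apply: eq_bigr => h _; rewrite mulgVK.
have -> : \sum_(k <- D) P (k * g)%g * F k^-1%g =
   \sum_(k <- (D `|` finsupp P)%fset) P (k * g)%g * F k^-1%g.
  apply: big_fset_incl; first exact: fsubsetUl.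
  move=> k _ kD; rewrite fsfun_dflt ?mul0r //; apply: contra kD => kg.
  by apply/imfsetP; exists (k * g)%g => //; rewrite mulgK.
rewrite (mean_widen _ (fsubsetUr D (finsupp P))) big_distrr /=.
apply: ler_sum => k _; rewrite !mulrA.
case: (boolP (k \in V)) => kV; last by rewrite mulr0 mul0r mulr_ge0 // PP.1.
by rewrite mulr1 ler_wpM2r //; apply: HV0; rewrite -in_setE.
Qed.

Variables (I : finType) (X : G -> I -> int) (g : I -> G) (b : nat).
Hypothesis Xg : forall x h y, X h y = (if y == x then b%:Z else 0) + X (g x * h)%g y.
Hypothesis HV : forall x h, V h -> (1 - eps) * P h <= P (h * g x)%g.
Hypothesis b0 : (0 < b)%N.

(** Double counting of the pairs of a configuration and a site among its [i]
    largest lamps. There are at least [i] such sites in every configuration, and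
    raising the lamp loses little mass by almost invariance; after that
    the lamp exceeds the value of rank [i] by [b]. Since at most [i] lamps can do
    so, most of them do in most configurations. *)
Lemma mean_exceed_ge i : (i < #|I|)%N ->
  (1 - eps) ^+ 2 * i%:R <= mean P (fun h => (exceed (X h) i b)%:R).
Proof.
move=> iI.
pose top h x := (#|[set y | (X h x < X h y)%R]| < i)%N.
apply: (@le_trans _ _ (\sum_x mean P (fun h => (top (g x * h)%g x)%:R))); last first.
  rewrite -(expe_sum PE); apply: (expe_le PE) => h.
  rewrite /exceed -sum1_card natr_sum [leRHS]big_mkcond /=.
  apply: ler_sum => x _; rewrite inE.
  case: (boolP (top _ x)) => [/(raised_exceeds iI (Xg x h)) -> //|_].
  by case: ifP.
apply: (@le_trans _ _ (\sum_x (1 - eps) *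
    mean P (fun h => (h \in V)%:R * (top h^-1%g x)%:R))); last first.
  by apply: ler_sum => x _; apply: (@transport_le (g x) (fun h => (top h x)%:R)) => // h; apply: HV.
rewrite -big_distrr /= -(expe_sum PE) expr2 -mulrA.
have e0 : 0 <= 1 - eps by rewrite subr_ge0.
rewrite ler_wpM2l //; apply: (@le_trans _ _ (mass P V * i%:R)).
  by rewrite ler_wpM2r.
rewrite mean_indic -(expeZr PE); apply: (expe_le PE) => h.
rewrite -big_distrr /= ler_wpM2l // -natr_sum ler_nat.
suff -> : (\sum_x top h^-1%g x)%N = #|[set x | top h^-1%g x]|.
  exact: rank_count (ltnW iI).
rewrite -sum1_card [RHS]big_mkcond /=; apply: eq_bigr => x _.
by rewrite inE; case: (top _ x).
Qed.

(** On average a positive proportion of the [L] dyadic ranks is followed by a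
    gap of size [b]. If the lamps are confined to an interval of length
    [2 * lam] with high probability, the gaps have to fit into it. *)
Lemma gap_sum_le (L : nat) (lam delta : R) : (2 ^ L < #|I|)%N -> 0 <= lam ->
  mean P (fun h => [exists x, (lam < `|(X h x)%:~R|)%R]%:R) <= delta ->
  L%:R * b%:R * (2 * (1 - eps) ^+ 2 - 1 - delta) <= 2 * lam.
Proof.
move=> LI lam0 hdelta.
have lI (l : 'I_L) : (2 ^ l.+1 < #|I|)%N.
  by apply: leq_ltn_trans LI; rewrite leq_pexp2l.
have b00 : 0 <= b%:R :> R by [].
pose term h (l : nat) : R := b%:R * (2 * (exceed (X h) (2 ^ l.+1) b)%:R / (2 ^ l.+1)%:R - 1).
have low : L%:R * b%:R * (2 * (1 - eps) ^+ 2 - 1) <= mean P (fun h => \sum_(l < L) term h l).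
  rewrite (expe_sum PE) -mulrA -[X in X%:R * _](card_ord L) mulr_natl -sumr_const.
  apply: ler_sum => l _.
  have q0 : 0 < (2 ^ l.+1)%:R :> R by rewrite ltr0n expn_gt0.
  rewrite /term (expeZ PE) ler_wpM2l // (expeB PE) (expe1 PE) lerD2r (expeZr PE) (expeZ PE).
  by rewrite -mulrA ler_wpM2l // ler_pdivlMr // mean_exceed_ge.
have up : mean P (fun h => \sum_(l < L) term h l) <= 2 * lam + L%:R * b%:R * delta.
  apply: (@le_trans _ _ (mean P (fun h => 2 * lam + L%:R * b%:R *
      [exists x, (lam < `|(X h x)%:~R|)%R]%:R))).
    apply: (expe_le PE) => h; case: (boolP [exists x, _]) => [_|].
      rewrite mulr1 -[leLHS]add0r lerD ?mulr_ge0 //.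
      rewrite -[X in X%:R * _](card_ord L) mulr_natl -sumr_const.
      apply: ler_sum => l _; rewrite /term ler_piMr //.
      have q0 : 0 < (2 ^ l.+1)%:R :> R by rewrite ltr0n expn_gt0.
      rewrite lerBlDr ler_pdivrMr // -[1 + 1]/(2%:R).
      by rewrite ler_wpM2l // ler_nat exceed_le.
    rewrite negb_exists => /forallP hx; rewrite mulr0 addr0.
    apply: (le_trans (ostat_spread R (X h) LI b0)).
    apply: ostat_range => //; last by move=> x; rewrite leNgt hx.
    by apply: leq_ltn_trans LI; rewrite expn_gt0.
  by rewrite (expeD PE) (expe_cst PE) (expeZ PE) lerD2l ler_wpM2l // mulr_ge0.
have := le_trans low up; rewrite mulrBr; lra.
Qed.

End Transport.

(** * The radius of almost invariance *)

Section Rate.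
Variable R : realType.

(** Replacing [n] by a power of a power of two turns the window size and the
    fractional powers of [n] into powers of the integer [2 ^ L]. *)
Lemma dyadic_scale (p n L0 : nat) : (0 < p)%N -> (2 ^ (L0 * p) <= n)%N ->
  exists L, [/\ (L0 <= L)%N, ((2 ^ L) ^ p <= n)%N & (n < 2 ^ p * (2 ^ L) ^ p)%N].
Proof.
move=> p0 nL; have n0 : (0 < n)%N by apply: leq_trans nL; rewrite expn_gt0.
have /andP[lo hi] := trunc_log_bounds (isT : (1 < 2)%N) n0.
exists (trunc_log 2 n %/ p)%N; split.
- by rewrite leq_divRL // -(trunc_expnK (L0 * p) (isT : (1 < 2)%N)) leq_trunc_log.
- by rewrite -expnM; apply: leq_trans lo; rewrite leq_exp2l // leq_trunc_div.
- rewrite -expnM -expnD; apply: (leq_trans hi); rewrite leq_exp2l //.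
  by rewrite -mulSn ltn_ceil.
Qed.

(** In terms of [q = 2 ^ L] the rate is at least of the order of
    [q ^ 4 / sqrt L]. *)
Lemma rate_ge (j L n : nat) : (0 < L)%N ->
  ((2 ^ L) ^ (2 ^ (j + 4)) <= n)%N -> (n < 2 ^ 2 ^ (j + 4) * (2 ^ L) ^ (2 ^ (j + 4)))%N ->
  (2 ^ L)%:R ^+ 4 / (Num.sqrt (2 * 2 ^ (j + 4))%:R * Num.sqrt L%:R) <=
  (n%:R : R) `^ (2 ^+ j.+2)^-1 / Num.sqrt (ln (n%:R : R)).
Proof.
move=> L0 lo hi; set p := (2 ^ (j + 4))%N in lo hi *; set q := (2 ^ L)%N in lo hi *.
have q1 : 1 <= q%:R :> R by rewrite ler1n expn_gt0.
have p0 : (0 < p)%N by rewrite expn_gt0.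
have n1 : 1 < n%:R :> R.
  rewrite ltr1n; apply: leq_trans lo; rewrite -expnM.
  by apply: (@leq_trans (2 ^ 1)) => //; rewrite leq_exp2l // muln_gt0 L0.
have n0 : 0 < n%:R :> R := lt_trans ltr01 n1.
have ln0 : 0 < ln (n%:R : R) by apply: ln_gt0.
have lnle : ln (n%:R : R) <= (2 * p)%:R * L%:R.
  apply: (@le_trans _ _ (ln (2 ^+ (p + L * p) : R))).
    rewrite ler_ln ?posrE ?exprn_gt0 // -natrX ler_nat expnD expnM.
    exact: ltnW.
  rewrite lnXn // -[_ *+ (p + L * p)]mulr_natl -natrM.
  have l2 : ln (2 : R) <= 1.
    by rewrite [X in ln X](_ : _ = 1 + 1) //; apply: le_ln1Dx; lra.
  apply: (@le_trans _ _ (p + L * p)%:R); first by rewrite ler_piMr.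
  rewrite ler_nat [(L * p)%N]mulnC mul2n -addnn mulnDl leq_add2r.
  by rewrite leq_pmulr.
have num : q%:R ^+ 4 <= (n%:R : R) `^ (2 ^+ j.+2)^-1.
  have -> : q%:R ^+ 4 = (q%:R ^+ p : R) `^ (2 ^+ j.+2)^-1.
    have pE : p%:R = 4 * 2 ^+ j.+2 :> R.
      by rewrite /p natrX exprD !exprS expr0; ring.
    rewrite -[q%:R ^+ p]powR_mulrn ?ler0n // -powRrM pE mulfK ?expf_neq0 //.
    by rewrite (powR_mulrn 4) ?ler0n.
  apply: ge0_ler_powR; rewrite ?nnegrE ?invr_ge0 ?exprn_ge0 ?ler0n //.
  by rewrite -natrX ler_nat.
have s0 : 0 < Num.sqrt (2 * p)%:R * Num.sqrt L%:R :> R.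
  by rewrite mulr_gt0 // sqrtr_gt0 ltr0n // muln_gt0.
apply: ler_pM => //.
rewrite lef_pV2 ?posrE // ?sqrtr_gt0 // -sqrtrM ?ler0n //.
exact: ler_wsqrtr.
Qed.

End Rate.

Theorem proposition4p3 (R : realType) (j : nat) (hj : (1 <= j)%N)
    (S : {fset iter_wreath j}) (hS : generates S)
    (mu : fsmeas R (iter_wreath j)) (hmu : is_sws_walk mu) :
  radius_ai_preceq S mu
    (fun n : nat => (n%:R : R) `^ (2 ^+ j.+1)^-1 / Num.sqrt (ln (n%:R : R))).
Proof.
case: j hj S hS mu hmu => // j _ S hS mu hmu r' _ [phi [phi_mono lim]] ai.
set p := (2 ^ (j + 4))%N; 
set r := fun n : nat => (n%:R : R) `^ (2 ^+ j.+2)^-1 / Num.sqrt (ln (n%:R : R)) in lim.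
have [C [L0 [C0 HC]]] := @window_lamp_le R j mu (4^-1) (2 ^ p)%:R hmu
   (ltac:(by rewrite invr_gt0)) (ler0n _ _).
have [c [c0 Hc]] := raise_length hS.
have cR : 0 < c%:R :> R by rewrite ltr0n.
set s := Num.sqrt (2 * p)%:R : R.
have s0 : 0 < s by rewrite sqrtr_gt0 ltr0n muln_gt0 expn_gt0.
have [N0 _ HN0] := ai (8^-1) (ltac:(by rewrite invr_gt0)).
have [K0 _ HK0] := (cvgryPge _).1 lim ((8 * C + 4) * c%:R * s).
(* Late enough for the divergence, for the almost invariance and for the bound
   on the lamps of the window. *)
pose k := maxn (maxn K0 N0) (2 ^ (L0.+1 * p)).
have phik m : (m <= phi m)%N.
  elim: m => // m IH; apply: leq_ltn_trans IH _; exact: phi_mono.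
set n := phi k.
have nN0 : (N0 <= n)%N.
  by apply: leq_trans (phik k); rewrite /k !leq_max leqnn orbT.
have nL : (2 ^ (L0.+1 * p) <= n)%N.
  by apply: leq_trans (phik k); rewrite /k leq_max leqnn orbT.
have p0 : (0 < p)%N by rewrite expn_gt0.
have [L [LL lo hi]] := dyadic_scale p0 nL.
have L1 : (0 < L)%N by apply: leq_ltn_trans LL.
set q := (2 ^ L)%N in lo hi.
have ratio : (8 * C + 4) * c%:R * s <= r' n / r n.
  by apply: (HK0 k); rewrite /= /k !leq_max leqnn.
have [V [massV HV]] := HN0 n nN0.
have rge : q%:R ^+ 4 / (s * Num.sqrt L%:R) <= r n := rate_ge R L1 lo hi.
set rt := Num.sqrt L%:R : R in rge.
have rt0 : 0 < rt by rewrite sqrtr_gt0 ltr0n.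
have rt2 : rt ^+ 2 = L%:R by rewrite sqr_sqrtr.
have q0 : 0 < q%:R :> R by rewrite ltr0n expn_gt0.
have q1 : 1 <= q%:R :> R by rewrite ler1n expn_gt0.
have rtq : rt <= q%:R.
  apply: (@le_trans _ _ L%:R); last by rewrite ler_nat ltnW // ltn_expl.
  by rewrite -rt2 expr2 ler_peMl ?(ltW rt0) // -[leLHS]sqrtr1 ler_wsqrtr // ler1n.
have big : (8 * C + 4) * q%:R ^+ 4 / rt <= r' n / c%:R.
  have rn0 : 0 < r n by apply: lt_le_trans rge; rewrite divr_gt0 ?exprn_gt0 ?mulr_gt0.
  move: ratio; rewrite ler_pdivlMr // => ratio.
  rewrite ler_pdivlMr //; apply: le_trans ratio.
  have -> : (8 * C + 4) * q%:R ^+ 4 / rt * c%:R =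
     (8 * C + 4) * c%:R * s * (q%:R ^+ 4 / (s * rt)).
    by field; rewrite !lt0r_neq0.
  apply: ler_wpM2l => //; apply: mulr_ge0 (ltW s0); apply: mulr_ge0 => //.
  by apply: addr_ge0 => //; apply: mulr_ge0.
have rtq4 : 4 * q%:R <= r' n / c%:R.
  apply: le_trans big; rewrite ler_pdivlMr //.
  have qrt : q%:R * rt <= q%:R ^+ 4.
    apply: (@le_trans _ _ (q%:R ^+ 2)); first by rewrite expr2 ler_wpM2l // ltW.
    by rewrite ler_weXn2l.
  have : 0 <= 8 * C * q%:R ^+ 4 by rewrite !mulr_ge0 // exprn_ge0 // ltW.
  rewrite mulrDl -mulrA; lra.
have rc0 : 0 <= r' n / c%:R by apply: le_trans rtq4; rewrite mulr_ge0 // ltW.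
have /andP[Tlo Thi] := truncn_itv rc0.
(* Going to a site of the window and back costs at most [2 * q]; what is left
   of the radius pays for the increment [b]. *)
set T := Num.trunc _ in Tlo Thi.
have Tq : (4 * q <= T)%N by rewrite truncn_ge_nat // natrM.
have qn0 : (0 < q)%N by rewrite expn_gt0.
pose b := (T - 2 * q)%N.
have bT : (2 * q + b)%N = T by rewrite subnKC // (leq_trans _ Tq) // leq_mul2r orbT.
have b0 : (0 < b)%N by rewrite subn_gt0 (leq_trans _ Tq) // ltn_mul2r qn0.
pose g (x : 'I_q.+1) := (embed j (raise x b))^-1%g.
have muP := sws_walk_prob hmu.
have near x h : V h -> (1 - 8^-1) * convol_pow mu n h <= convol_pow mu n (h * g x)%g.
  move=> Vh; have := HV h (g x) Vh; case.
    apply: (@le_trans _ _ (c * T)%:R); last first.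
      by rewrite natrM mulrC -ler_pdivlMr.
    rewrite ler_nat; apply: leq_trans (Hc x b) _.
    by rewrite -bT leq_mul // leq_add2r leq_mul // -ltnS ltn_ord.
  move=> h0; rewrite ler_norml => /andP[+ _].
  by rewrite lerBrDr -ler_pdivlMr // addrC.
have eps1 : (8^-1 : R) <= 1 by rewrite invf_le1 // ler1n.
have shift (x : 'I_q.+1) h (y : 'I_q.+1) : lamp h (y : nat)%:Z =
    (if y == x then b%:Z else 0) + lamp (g x * h)%g (y : nat)%:Z :> int.
  by rewrite -[in LHS](mulVKg (embed j (raise x b)) h) lamp_raise.
have Lam0 : 0 <= C * q%:R ^+ 4 * rt by rewrite !mulr_ge0 // ?exprn_ge0 // ltW.
have LI : (2 ^ L < #|'I_q.+1|)%N by rewrite card_ord.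
have over : mean (convol_pow mu n) (fun h => (overflow q (C * q%:R ^+ 4 * rt) (lamp h))%:R) <= 4^-1.
  apply: HC; first exact: ltnW.
  by rewrite -natrX -natrM ler_nat ltnW.
have := gap_sum_le (convol_pow_prob n muP) (mean_sym_pow n (sws_walk_sym hmu)) eps1 massV
  (X := fun h (x : 'I_q.+1) => lamp h (x : nat)%:Z : int) shift near b0 LI Lam0 over.
have brt : (8 * C + 4) * q%:R ^+ 4 / rt - 3 * q%:R <= b%:R.
  have : T%:R = 2 * q%:R + b%:R :> R by rewrite -bT natrD natrM.
  move: Thi; rewrite -addn1 natrD; move: big; lra.
move=> gap.
have Lb : L%:R * b%:R <= 8 * C * q%:R ^+ 4 * rt.
  have : 0 <= L%:R * b%:R :> R by rewrite mulr_ge0.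
  move: gap; set u := L%:R * b%:R; set w := C * _ * _.
  rewrite (_ : 8 * C * _ * _ = 8 * w); last by rewrite /w !mulrA.
  by lra.
have brt' : b%:R * rt <= 8 * C * q%:R ^+ 4.
  have e : rt * (b%:R * rt) = L%:R * b%:R by rewrite -rt2; ring.
  by rewrite -(ler_pM2l rt0) e [leRHS]mulrC.
have : ((8 * C + 4) * q%:R ^+ 4 / rt - 3 * q%:R) * rt <= b%:R * rt.
  by rewrite ler_wpM2r // ltW.
rewrite mulrBl divfK ?lt0r_neq0 // => h2.
have q2 : q%:R * rt <= q%:R ^+ 4.
  apply: (@le_trans _ _ (q%:R ^+ 2)); first by rewrite expr2 ler_wpM2l // ltW.
  by rewrite ler_weXn2l.
have q4 : 0 < q%:R ^+ 4 :> R by rewrite exprn_gt0.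
move: (le_trans h2 brt'); rewrite mulrDl -[3 * _ * _]mulrA; lra.
Qed.
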